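(* Let $(T_t)_{t\in\mathbb{R}}$ be a measurable ergodic measure-preserving flow on a standard Borel probability space $(X,\mathcal{B},\mu)$ and let $\sigma$ be its reduced maximal spectral type on $\mathbb{R}$. Assume that there exists a sequence $(t_n)_{n\in\mathbb{N}}$ of real numbers such that the operators $T_{t_n}$ on $L^2_0(X,\mathcal{B},\mu)$ converge weakly to an operator $V$ which is not of the form $cT_s$ ($c\in\mathbb{C}$, $s\in\mathbb{R}$), and such that $\phi_V$ is analytic. Then $\sigma$ is singular with respect to the convolution $\lambda_1*\lambda_2$ of any two continuous measures $\lambda_1,\lambda_2$ on $\mathbb{R}$.
   Context: $T_t$ also denotes the associated unitary operator on $L^2(X,\mathcal{B},\mu)$, and $L^2_0$ is the orthocomplement of the constants. The reduced maximal spectral type $\sigma$ is the maximal spectral type of the unitary one-parameter group $(T_t)$ on $L^2_0$, a finite positive Borel measure on $\mathbb{R}$ (defined up to equivalence); $T_t$ on $L^2_0$ corresponds spectrally to multiplication by $s\mapsto e^{2\pi i ts}$. If $T_{t_n}\to V$ weakly, then $V$ corresponds to multiplication by a function $\phi_V\in L^\infty(\mathbb{R},\sigma)$ which is the weak-$*$ limit of $(e^{2\pi i t_n\cdot})$ in $L^\infty(\mathbb{R},\sigma)$. ''$\phi_V$ is analytic'' means that it coincides $\sigma$-almost everywhere with a (complex-valued) real-analytic function on $\mathbb{R}$. A continuous measure is a finite positive Borel measure without atoms. *)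

(* Defs.v *)
From HB Require Import structures.
From mathcomp Require Import all_boot all_order all_algebra.
From mathcomp Require Import all_classical all_reals all_analysis.
From mathcomp Require Import complex.

Set Implicit Arguments.
Unset Strict Implicit.
Unset Printing Implicit Defensive.

Import Order.TTheory GRing.Theory Num.Theory.
Import numFieldNormedType.Exports.

Local Open Scope classical_set_scope.
Local Open Scope ring_scope.
Local Open Scope complex_scope.

(* MathComp-Analysis world; the complex numbers are [R[i]] with [R : realType]. *)

(* The topology of the modulus on [R[i]] is the one MathComp-Analysis puts on
   every numFieldType; it is only inferred through an explicit coercion. *)
Definition ccvg (R : realType) (u : nat -> R[i]) (l : R[i]) : Prop :=
  (u : nat -> (R[i] : numFieldType)) @ \oo --> (l : (R[i] : numFieldType)).

Section ComplexFunctions.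
Context d (X : measurableType d) (R : realType).
Implicit Types (mu : {measure set X -> \bar R}) (f g : X -> R[i]).

(* The complex space L^p, as a set of representatives: equality of classes is
   always spelled out as almost everywhere equality. *)
Definition cLfun mu (p : \bar R) : set (X -> R[i]) :=
  [set f : X -> R[i] | (fun x => complex.Re (f x)) \in Lfun mu p /\
           (fun x => complex.Im (f x)) \in Lfun mu p].

Definition cintegral mu f : R[i] :=
  (\int[mu]_x complex.Re (f x)) +i* (\int[mu]_x complex.Im (f x)).

Definition inner mu f g : R[i] := cintegral mu (fun x => f x * (g x)^*).

Definition L20 mu : set (X -> R[i]) :=
  [set f : X -> R[i] | cLfun mu 2%:E f /\ forall c : R[i], inner mu f (fun=> c) = 0].

End ComplexFunctions.

(* Isomorphic, as a measurable space, to a Polish space with its Borel sets. *)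
Definition standard_borel d (X : measurableType d) (R : realType) : Prop :=
  exists Y : completePseudoMetricType R,
    [/\ hausdorff_space Y,
        exists2 S : set Y, countable S & dense S &
        exists2 h : X -> Y, bijective h &
          forall A : set Y, <<s [set U : set Y | open U] >> A <->
                            measurable (h @^-1` A)].

Section Flows.
Context d (X : measurableType d) (R : realType).
Variables (mu : {measure set X -> \bar R}) (T : R -> X -> X).

Definition measurable_mp_flow : Prop :=
  [/\ measurable_fun [set: R * X] (fun p : R * X => T p.1 p.2),
      forall x, T 0 x = x,
      forall s t x, T (s + t) x = T s (T t x) &
      forall t A, measurable A -> mu (T t @^-1` A) = mu A].

Definition ergodic_flow : Prop :=
  forall A, measurable A -> (forall t, T t @^-1` A = A) ->
    mu A = 0%E \/ mu (~` A) = 0%E.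

Definition koopman (t : R) (f : X -> R[i]) : X -> R[i] := f \o T t.

(* [V], acting on representatives, induces a bounded linear operator
   on L^2_0. *)
Record L20_operator (V : (X -> R[i]) -> (X -> R[i])) : Prop := {
  L20_operator_stable : forall f, L20 mu f -> L20 mu (V f) ;
  L20_operator_ae : forall f g, L20 mu f -> L20 mu g ->
    {ae mu, forall x, f x = g x} -> {ae mu, forall x, V f x = V g x} ;
  L20_operator_linear : forall (a : R[i]) f g, L20 mu f -> L20 mu g ->
    {ae mu, forall x, V (fun y => a * f y + g y) x = a * V f x + V g x} ;
  L20_operator_bounded : exists M : R, forall f, L20 mu f ->
    complex.Re (inner mu (V f) (V f)) <= M * complex.Re (inner mu f f) }.

Definition koopman_cvg_weakly (t_ : nat -> R)
    (V : (X -> R[i]) -> (X -> R[i])) : Prop :=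
  forall f g, L20 mu f -> L20 mu g ->
    ccvg (fun n => inner mu (koopman (t_ n) f) g) (inner mu (V f) g).

Definition is_scaled_koopman (V : (X -> R[i]) -> (X -> R[i])) (c : R[i])
    (s : R) : Prop :=
  forall f, L20 mu f -> {ae mu, forall x, V f x = c * koopman s f x}.

End Flows.

Section Spectrum.
Context (R : realType).

Definition expi2pi (x : R) : R[i] := cos (2 * pi * x) +i* sin (2 * pi * x).

Definition spectral_measure d (X : measurableType d)
    (mu : {measure set X -> \bar R}) (T : R -> X -> X) (f : X -> R[i])
    (nu : {finite_measure set R -> \bar R}) : Prop :=
  forall t : R,
    inner mu (koopman T t f) f = cintegral nu (fun s => expi2pi (t * s)).

(* Every spectral measure on L^2_0 is absolutely continuous with respect to
   [sigma], and some spectral measure is equivalent to [sigma]: this determines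
   [sigma] up to equivalence. *)
Definition reduced_maximal_spectral_type d (X : measurableType d)
    (mu : {measure set X -> \bar R}) (T : R -> X -> X)
    (sigma : {finite_measure set R -> \bar R}) : Prop :=
  (forall f, L20 mu f -> exists nu : {finite_measure set R -> \bar R},
     spectral_measure mu T f nu /\ nu `<< sigma) /\
  (exists2 f, L20 mu f & exists nu : {finite_measure set R -> \bar R},
     [/\ spectral_measure mu T f nu, nu `<< sigma & sigma `<< nu]).

Definition weak_star_limit (sigma : {finite_measure set R -> \bar R})
    (u : nat -> R -> R[i]) (phi : R -> R[i]) : Prop :=
  cLfun sigma +oo%E phi /\
  forall g, cLfun sigma 1%E g ->
    ccvg (fun n => cintegral sigma (fun s => g s * u n s))
         (cintegral sigma (fun s => g s * phi s)).

(* [phi] is the function phi_V.  That V is multiplication by [phi] in the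
   spectral representation is expressed through the quadratic form
   <V f, f> = \int phi d(sigma_f), which determines V by polarization. *)
Definition spectral_multiplier d (X : measurableType d)
    (mu : {measure set X -> \bar R}) (T : R -> X -> X)
    (sigma : {finite_measure set R -> \bar R}) (t_ : nat -> R)
    (V : (X -> R[i]) -> (X -> R[i])) (phi : R -> R[i]) : Prop :=
  weak_star_limit sigma (fun n s => expi2pi (t_ n * s)) phi /\
  forall f (nu : {finite_measure set R -> \bar R}), L20 mu f ->
    spectral_measure mu T f nu -> inner mu (V f) f = cintegral nu phi.

Definition real_analytic (f : R -> R[i]) : Prop :=
  forall x0 : R, exists2 r : R, 0 < r & exists a : nat -> R[i],
    forall x, `|x - x0| < r ->
      ccvg (fun n => \sum_(k < n) a k * (x - x0)%:C ^+ k) (f x).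

Definition continuous_measure (lam : {finite_measure set R -> \bar R}) : Prop :=
  forall x : R, lam [set x] = 0%E.

Definition convolution (lam1 lam2 : {finite_measure set R -> \bar R}) :
    set R -> \bar R :=
  pushforward (lam1 \x lam2)%E (fun p : R * R => p.1 + p.2).

Definition mutually_singular (m1 m2 : set R -> \bar R) : Prop :=
  exists2 N : set R, measurable N & m1 N = 0%E /\ m2 (~` N) = 0%E.

End Spectrum.

(* Main.v *)
Require Import Defs.
From HB Require Import structures.
From mathcomp Require Import all_boot all_order all_algebra.
From mathcomp Require Import all_classical all_reals all_analysis.
From mathcomp Require Import measurable_realfun complex ring lra.

Set Implicit Arguments.
Unset Strict Implicit.
Unset Printing Implicit Defensive.

Import Order.TTheory GRing.Theory Num.Theory.
Import numFieldNormedType.Exports.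

Local Open Scope classical_set_scope.
Local Open Scope ring_scope.
Local Open Scope complex_scope.

(** Suppose that [sigma] is not singular with respect to [lam1 * lam2]. By
    Lebesgue decomposition ([absolutely_continuous_part]) there is a set [A] of
    positive convolution mass on which the convolution is absolutely continuous
    with respect to [sigma]. Let [E] be the set of pairs [(x, y)] with [x + y] in
    [A]. The characters [e(t_n s)] converge weak-star to [phi] with respect to
    [sigma], so [e(t_n (x + y))] converges weakly to [phi (x + y)] on [E]
    ([weak_star_transfer]). On the other hand [e(t_n (x + y))] is the product of
    [e(t_n x)] and [e(t_n y)]; these have weak limits [phi1] and [phi2] along an
    ultrafilter, with respect to [lam1] and [lam2], and weak limits are
    multiplicative on product functions ([ultra_weak_tensor]). Hence
    [phi1 x * phi2 y = phi (x + y)] almost everywhere on [E]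
    ([weak_star_factorization]), and [phi] can be replaced by its analytic
    version [h].

    Such a factorization is rigid ([sum_factorization_rigid]). The sections of [E]
    over a set of [x] of positive mass have positive mass; [lam1] has no atoms, so
    by pigeonhole there are distinct [x], [x'], as close as one likes, whose
    sections meet in positive mass. Since [lam2] has no atoms, the sections meet
    in a set with an accumulation point, and the identity theorem gives that
    [h (x' + .)] is proportional to [h (x + .)] on the whole line. Proportionality
    of [h] and its translate by [p] is an analytic condition on [p]; holding for
    arbitrarily small nonzero [p], it holds for all [p].

    Up to a factor [h] is therefore a differentiable homomorphism from the line to
    the nonzero complex numbers, unless it is zero. It has constant modulus
    because it is hermitian: the Koopman operators commute with complex
    conjugation, so the spectral type is symmetric ([spectral_type_symmetric],
    which rests on [fourier_uniqueness]) and the weak-star limit of characters is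
    hermitian almost everywhere; the identity theorem extends this to [h]. So
    [h s = c * e(s0 s)] ([hermitian_exponential]). Then [V] and [c T_s0] have the
    same quadratic form and are equal by polarization
    ([scaled_koopman_of_quadratic]), which was excluded. *)

(** * Bounded measurable functions *)

Section BoundedMeasurable.
Context d (T : measurableType d) (R : realType).
Implicit Types (g h : T -> R).

Definition bounded_measurable g :=
  measurable_fun [set: T] g /\ exists M, forall x, `|g x| <= M.

Lemma bounded_measurable_cst c : bounded_measurable (cst c : T -> R).
Proof. by split; [exact: measurable_cst | exists `|c|]. Qed.

Lemma bounded_measurableD g h : bounded_measurable g -> bounded_measurable h ->
  bounded_measurable (fun x => g x + h x).
Proof.
move=> [mg [M gM]] [mh [N hN]]; split; first exact: measurable_funD.
by exists (M + N) => x; rewrite (le_trans (ler_normD _ _))// lerD.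
Qed.

Lemma bounded_measurableM g h : bounded_measurable g -> bounded_measurable h ->
  bounded_measurable (fun x => g x * h x).
Proof.
move=> [mg [M gM]] [mh [N hN]]; split; first exact: measurable_funM.
by exists (M * N) => x; rewrite normrM ler_pM.
Qed.

Lemma bounded_measurableN g : bounded_measurable g ->
  bounded_measurable (fun x => - g x).
Proof.
move=> [mg [M gM]]; split; first exact: measurableT_comp.
by exists M => x; rewrite normrN.
Qed.

Lemma bounded_measurable_cos g : measurable_fun [set: T] g ->
  bounded_measurable (fun x => cos (g x)).
Proof.
move=> mg; split; last by exists 1 => x; rewrite ler_norml cos_geN1 cos_le1.
by apply: measurableT_comp => //; apply: continuous_measurable_fun; exact: continuous_cos.
Qed.

Lemma bounded_measurable_sin g : measurable_fun [set: T] g ->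
  bounded_measurable (fun x => sin (g x)).
Proof.
move=> mg; split; last by exists 1 => x; rewrite ler_norml sin_geN1 sin_le1.
by apply: measurableT_comp => //; apply: continuous_measurable_fun; exact: continuous_sin.
Qed.

Lemma bounded_measurable_integrable (m : {finite_measure set T -> \bar R}) D g :
  measurable D -> bounded_measurable g -> m.-integrable D (EFin \o g).
Proof.
move=> mD [mg [M gM]].
apply: (@le_integrable _ _ _ m D mD _ (cst M%:E)).
- by apply/measurable_EFinP; exact: measurable_funTS.
- by move=> x _ /=; rewrite lee_fin (le_trans (gM x))// ler_norm.
- apply: finite_measure_integrable_cst => //.
Qed.

Lemma Rintegral_cvg_bounded (m : {finite_measure set T -> \bar R}) D
    (g_ : nat -> T -> R) g M : measurable D ->
  (forall n, measurable_fun [set: T] (g_ n)) ->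
  (forall n x, `|g_ n x| <= M) -> (forall x, g_ ^~ x @ \oo --> g x) ->
  \int[m]_(x in D) g_ n x @[n --> \oo] --> \int[m]_(x in D) g x.
Proof.
move=> mD mg_ gM cg.
have mg : measurable_fun [set: T] g.
  by apply: (@measurable_fun_cvg _ _ _ _ g_) => // x _; exact: cg.
have [|||||ig _ cI] := @dominated_convergence _ _ _ m D mD
    (fun n x => (g_ n x)%:E) (EFin \o g) (cst M%:E).
- by move=> n; apply/measurable_EFinP/measurable_funTS.
- by apply/measurable_EFinP/measurable_funTS.
- by apply: aeW => x Dx /=; apply: cvg_EFin; [exact: nearW | exact: cg].
- exact: finite_measure_integrable_cst.
- by apply: aeW => x n _ /=; rewrite lee_fin.
by apply: fine_cvg; rewrite fineK; [exact: cI | exact: integrable_fin_num].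
Qed.

End BoundedMeasurable.

(** * Uniqueness of the Fourier transform of a finite measure on the line *)

Section PowerThreshold.
Context (R : realType).
Implicit Types (x y : R).

Lemma bernoulli_ineq x n : -1 <= x -> 1 + n%:R * x <= (1 + x) ^+ n.
Proof.
move=> x1; elim: n => [|n IH]; first by rewrite mul0r addr0 expr0.
rewrite exprS (le_trans _ (ler_wpM2l _ IH))//; last by lra.
have : 0 <= n%:R * x ^+ 2 by rewrite mulr_ge0 ?sqr_ge0.
rewrite -natr1; lra.
Qed.

Lemma invrn_cvg0 : (n.+1%:R : R)^-1 @[n --> \oo] --> (0 : R).
Proof. exact: cvg_harmonic. Qed.

(** Both bounds are Bernoulli's inequality. *)
Lemma threshold_lower x n : 0 <= x < 1 / 2 ->
  1 - n%:R * (2 * x) ^+ n.*2 <= (1 - x ^+ n.*2) ^+ (n * 4 ^ n).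
Proof.
move=> /andP[x0 x2].
have y0 : 0 <= x ^+ n.*2 by rewrite exprn_ge0.
have y1 : x ^+ n.*2 <= 1 by rewrite exprn_ile1//; lra.
have := @bernoulli_ineq (- x ^+ n.*2) (n * 4 ^ n); rewrite lerN2 => /(_ y1).
congr (_ <= _); rewrite exprMn natrM natrX.
have -> : (2 : R) ^+ n.*2 = 4 ^+ n by rewrite -mul2n exprM; congr (_ ^+ _); ring.
ring.
Qed.

Lemma threshold_upper x n : 1 / 2 <= x <= 1 ->
  (1 - x ^+ n.*2) ^+ (n * 4 ^ n) <= n.+1%:R^-1.
Proof.
move=> /andP[x2 x1].
have x0 : 0 <= x by lra.
set y := x ^+ n.*2.
have y0 : 0 <= y by rewrite exprn_ge0.
have y1 : y <= 1 by rewrite exprn_ile1.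
have yn : 1 <= 4 ^+ n * y.
  rewrite /y -mul2n exprM -exprMn exprn_ege1//.
  have : (1 / 2) * (1 / 2) <= x * x by rewrite ler_pM//; lra.
  by rewrite expr2; lra.
rewrite -[leRHS]div1r ler_pdivlMr//.
apply: (@le_trans _ _ ((1 - y) ^+ (n * 4 ^ n) * (1 + y) ^+ (n * 4 ^ n))).
  rewrite ler_wpM2l ?exprn_ge0 ?subr_ge0//.
  apply: le_trans (bernoulli_ineq _ _); last by lra.
  rewrite natrM natrX -natr1 addrC lerD2l -mulrA -[leLHS]mulr1.
  by rewrite ler_wpM2l.
rewrite -exprMn exprn_ile1//.
- by rewrite mulr_ge0//; lra.
- by have := sqr_ge0 y; lra.
Qed.

(** These polynomials are a sharp threshold at [1/2]: below it the power is at
    least [1 - n (2x)^(2n)], from it on at most [1/(n+1)]. The factor [n] in the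
    exponent is what forces the limit to be [0] at the threshold itself. *)
Lemma threshold_cvg x : 0 <= x <= 1 ->
  (1 - x ^+ n.*2) ^+ (n * 4 ^ n) @[n --> \oo] --> ((x < 1 / 2)%R%:R : R).
Proof.
move=> /andP[x0 x1].
have pow_ge0 n : 0 <= (1 - x ^+ n.*2) ^+ (n * 4 ^ n).
  by rewrite exprn_ge0// subr_ge0 exprn_ile1.
have pow_le1 n : (1 - x ^+ n.*2) ^+ (n * 4 ^ n) <= 1.
  rewrite exprn_ile1// ?subr_ge0 ?exprn_ile1//.
  by rewrite lerBlDr lerDl exprn_ge0.
have [xlt|xge] := ltP x (1 / 2).
- set w := 2 * x; have w0 : 0 <= w by rewrite /w; lra.
  have w1 : w < 1 by rewrite /w; lra.
  have [d d0 wd] : exists2 d, 0 < d & forall n, n%:R * w ^+ n <= d.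
    have [->|wn0] := eqVneq w 0.
      exists 1 => // -[|n]; first by rewrite mul0r.
      by rewrite expr0n mulr0.
    have wp : 0 < w by rewrite lt_neqAle eq_sym wn0.
    exists ((w^-1 - 1)^-1).
      by rewrite invr_gt0 subr_gt0 invf_gt1.
    move=> n; rewrite -[leRHS]mul1r ler_pdivlMr ?subr_gt0 ?invf_gt1//.
    have wi0 : 0 <= w^-1 by rewrite invr_ge0.
    have : 1 + n%:R * (w^-1 - 1) <= w ^- n.
      rewrite -exprVn -[X in X ^+ n](subrK 1) [w^-1 - 1 + 1]addrC.
      by apply: bernoulli_ineq; lra.
    rewrite -(@ler_pM2r _ (w ^+ n)) ?exprn_gt0// mulVf ?expf_neq0// => h1.
    have := exprn_ge0 n w0; move: h1; move: (w ^+ n) (w^-1) n%:R => a b c.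
    by lra.
  apply: (@squeeze_cvgr _ _ _ _ (fun n => 1 - d * w ^+ n) (cst 1)).
  + apply: nearW => n; rewrite pow_le1 andbT.
    apply: le_trans (threshold_lower n _); last by rewrite x0.
    rewrite lerB// -addnn exprD mulrA ler_wpM2r// exprn_ge0//.
  + rewrite [X in _ --> X](_ : _ = 1 - d * 0); last by rewrite mulr0 subr0.
    apply: cvgB; first exact: cvg_cst.
    by apply: cvgMr; apply: cvg_expr; rewrite ger0_norm.
  + exact: cvg_cst.
- apply: (@squeeze_cvgr _ _ _ _ (cst 0) (fun n => n.+1%:R^-1)).
  + by apply: nearW => n; rewrite pow_ge0/= threshold_upper// xge.
  + exact: cvg_cst.
  + exact: invrn_cvg0.
Qed.

End PowerThreshold.

Lemma indic_bool (T : Type) (R : pzRingType) (P : pred T) :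
  \1_[set s | P s] = (fun s => (P s)%:R) :> (T -> R).
Proof.
apply/funext => s; rewrite indicE; congr (_%:R : R); congr nat_of_bool.
by apply/idP/idP => [/set_mem|/mem_set].
Qed.

Section FourierUniqueness.
Context (R : realType) (n1 n2 : {finite_measure set R -> \bar R}).
Hypothesis hcos : forall t,
  \int[n1]_s cos (t * s) = \int[n2]_s cos (t * s).
Hypothesis hsin : forall t,
  \int[n1]_s sin (t * s) = \int[n2]_s sin (t * s).

Let agree (g : R -> R) := \int[n1]_s g s = \int[n2]_s g s.
Let bm := @bounded_measurable _ R R.

Let bm_int (m : {finite_measure set R -> \bar R}) g : bm g ->
  m.-integrable [set: R] (EFin \o g).
Proof. exact: bounded_measurable_integrable. Qed.

Let agreeD f g : bm f -> bm g -> agree f -> agree g ->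
  agree (fun s => f s + g s).
Proof.
by move=> bf bg af ag; rewrite /agree !RintegralD//; [congr (_ + _)|exact: bm_int..].
Qed.

Let agreeZ c f : bm f -> agree f -> agree (fun s => c * f s).
Proof. by move=> bf af; rewrite /agree !RintegralZl ?af//; exact: bm_int. Qed.

Let bm_wave t b : bm (fun s => cos (t * s + b)).
Proof.
by apply: bounded_measurable_cos; apply: measurable_funD.
Qed.

Let bm_wave_sin t : bm (fun s => sin (t * s)).
Proof.
by apply: bounded_measurable_sin; apply: measurable_funM.
Qed.

Let bmM f g : bm f -> bm g -> bm (fun s => f s * g s).
Proof. exact: bounded_measurableM. Qed.

Let agree_wave t b : agree (fun s => cos (t * s + b)).
Proof.
have bc : bm (fun s => cos (t * s)) by have := bm_wave t 0; under eq_fun do rewrite addr0.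
have E : (fun s => cos (t * s + b)) =
    (fun s => cos b * cos (t * s) + (- sin b) * sin (t * s)).
  by apply/funext => s; rewrite cosD; ring.
rewrite E; apply: agreeD; do ?[exact: agreeZ]; apply: bmM => //;
  exact: bounded_measurable_cst.
Qed.

(** The phase [b] makes a single family of waves stand for cosines and sines. *)
Let good g := bm g /\ forall t b, agree (fun s => g s * cos (t * s + b)).

Let multiplier p := bm p /\
  forall g, good g -> good (fun s => g s * p s).

Let multiplier_cst c : multiplier (cst c).
Proof.
split; first exact: bounded_measurable_cst.
move=> g [bg hg]; split; first by apply: bmM => //; exact: bounded_measurable_cst.
move=> t b; under [X in agree X]eq_fun do rewrite [_ * cst c _]mulrC -mulrA.
by apply: agreeZ => //; exact: bmM.
Qed.

Let multiplier_wave u c : multiplier (fun s => cos (u * s + c)).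
Proof.
split=> // g [bg hg]; split; first exact: bmM.
move=> t b.
have E : (fun s => g s * cos (u * s + c) * cos (t * s + b)) =
    (fun s => 2^-1 * (g s * cos ((t + u) * s + (b + c)))
      + 2^-1 * (g s * cos ((t - u) * s + (b - c)))).
  apply/funext => s.
  have -> : (t + u) * s + (b + c) = (t * s + b) + (u * s + c) by ring.
  have -> : (t - u) * s + (b - c) = (t * s + b) - (u * s + c) by ring.
  by move: (t * s + b) (u * s + c) => x y; rewrite cosD cosB; field.
rewrite E; apply: agreeD; do ?[apply: agreeZ => //; exact: bmM];
  apply: bmM; [exact: bounded_measurable_cst|exact: bmM|
               exact: bounded_measurable_cst|exact: bmM].
Qed.

Let multiplierD p q : multiplier p -> multiplier q ->
  multiplier (fun s => p s + q s).
Proof.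
move=> [bp hp] [bq hq]; split; first exact: bounded_measurableD.
move=> g gg; have [[_ gp] [_ gq]] := (hp _ gg, hq _ gg); case: gg => bg _.
split; first by apply: bmM => //; exact: bounded_measurableD.
move=> t b; under [X in agree X]eq_fun do rewrite mulrDr mulrDl.
by apply: agreeD => //; do 2 apply: bmM => //.
Qed.

Let multiplierM p q : multiplier p -> multiplier q ->
  multiplier (fun s => p s * q s).
Proof.
move=> [bp hp] [bq hq]; split; first exact: bmM.
by move=> g /hp/hq; under eq_fun do rewrite -mulrA.
Qed.

Let multiplierX p n : multiplier p -> multiplier (fun s => p s ^+ n).
Proof.
move=> mp; elim: n => [|n IH]; first exact: multiplier_cst.
by under eq_fun do rewrite exprS; exact: multiplierM.
Qed.

Let multiplier_agree p : multiplier p -> agree p.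
Proof.
move=> [_ /(_ (cst 1))[]]; last first.
  move=> _ /(_ 0 0); congr agree; apply/funext => s.
  by rewrite mul0r addr0 cos0 mulr1 mul1r.
split; first exact: bounded_measurable_cst.
move=> t b; rewrite (_ : (fun s => _) = (fun s => cos (t * s + b)))//.
by apply/funext => s; rewrite mul1r.
Qed.

Let agree_cvg (g_ : nat -> R -> R) g : (forall n, bm (g_ n)) ->
  (forall n x, `|g_ n x| <= 1) -> (forall x, g_ ^~ x @ \oo --> g x) ->
  (forall n, agree (g_ n)) -> agree g.
Proof.
move=> mg g1 cg ag.
have c (m : {finite_measure set R -> \bar R}) :=
  @Rintegral_cvg_bounded _ _ _ m setT g_ g 1 measurableT (fun n => (mg n).1) g1 cg.
have c1 := c n1; have c2 := c n2.
apply: (cvg_unique _ c1); first exact: Rhausdorff.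
rewrite (_ : (fun n => \int[n1]_x g_ n x) = (fun n => \int[n2]_x g_ n x)) in c1 *.
  exact: c2.
by apply/funext => n; exact: ag.
Qed.

(** The affine image of the sine in [0, 1] is on the good side of the threshold
    exactly when the sine is negative. *)
Let agree_sin_lt0 u c : agree (fun s => (sin (u * s + c) < 0)%R%:R).
Proof.
pose x s := 2^-1 + 2^-1 * cos (u * s + (c - pi / 2)).
have xE s : x s = 2^-1 + 2^-1 * sin (u * s + c) by rewrite /x addrA cosBpihalf.
have x01 s : 0 <= x s <= 1.
  by have := sin_geN1 (u * s + c); have := sin_le1 (u * s + c); rewrite xE; lra.
have mx : multiplier x.
  apply: multiplierD; first exact: multiplier_cst.
  by apply: multiplierM; [exact: multiplier_cst|exact: multiplier_wave].
have mpow n : multiplier (fun s => (1 - x s ^+ n.*2) ^+ (n * 4 ^ n)).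
  apply: multiplierX; apply: multiplierD; first exact: multiplier_cst.
  under eq_fun do rewrite -mulN1r.
  by apply: multiplierM; [exact: multiplier_cst|exact: multiplierX].
apply: (@agree_cvg (fun n s => (1 - x s ^+ n.*2) ^+ (n * 4 ^ n))).
- by move=> n; have [] := mpow n.
- move=> n s; have /andP[x0 x1] := x01 s.
  rewrite ger0_norm ?exprn_ge0 ?subr_ge0 ?exprn_ile1//.
  by rewrite subr_ge0 exprn_ile1.
  by rewrite lerBlDr lerDl exprn_ge0.
- move=> s.
  have -> : (sin (u * s + c) < 0) = (x s < 1 / 2).
    by rewrite xE; apply/idP/idP; lra.
  exact: threshold_cvg.
- by move=> n; exact: multiplier_agree.
Qed.

(** On a given bounded set, [sin ((s - a) / m)] has the sign of [s - a] for large
    [m], so that half-lines are bounded limits of the sets of the previous step. *)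
Let agree_ray a : agree (fun s => (s < a)%R%:R).
Proof.
apply: (@agree_cvg (fun n s => (sin (n.+1%:R^-1 * s + - (n.+1%:R^-1 * a)) < 0)%R%:R)).
- move=> n; split; last first.
    by exists 1 => x; case: (_ < _)%R; rewrite ?normr0 ?normr1.
  rewrite -indic_bool; apply: measurable_indic.
  rewrite -[X in measurable X]setTI; apply: measurable_fun_ltr => //.
  by apply: (bounded_measurable_sin _).1; apply: measurable_funD.
- by move=> n x; case: (_ < _)%R; rewrite ?normr0 ?normr1.
- move=> s; apply: cvg_near_cst.
  have c0 : n.+1%:R^-1 * (s - a) @[n --> \oo] --> (0 : R).
    by rewrite -[X in _ --> X](mul0r (s - a)); apply: cvgMl; exact: invrn_cvg0.
  near=> n.
  have : `|n.+1%:R^-1 * (s - a)| < 1.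
    by near: n; apply: (cvgr_norm_lt _ c0); rewrite normr0.
  have n0 : 0 < (n.+1%:R : R)^-1 by rewrite invr_gt0.
  rewrite -mulrBr; set t := _ * (s - a); rewrite ltr_norml => /andP[h1 h2].
  congr (_%:R : R); congr nat_of_bool.
  have [sa|sa] := ltP s a.
    have h3 : t < 0 by rewrite pmulr_rlt0// subr_lt0.
    have : 0 < sin (- t) by apply: sin2_gt0; lra.
    by rewrite sinN oppr_gt0.
  have h3 : 0 <= t by rewrite pmulr_rge0// subr_ge0.
  apply/negbTE; rewrite -leNgt.
  move: h3; rewrite le_eqVlt => /predU1P[<-|h3]; first by rewrite sin0.
  by apply/ltW/sin2_gt0; lra.
- by move=> n; exact: agree_sin_lt0.
Unshelve. all: by end_near. Qed.

(** The functions [p] such that multiplication by [p] preserves the agreement of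
    all integrals against waves form an algebra, which contains the waves by the
    product formula for cosines. Thresholding polynomials of waves and letting
    their period grow shows that the two measures agree on half-lines. *)
Lemma fourier_uniqueness (A : set R) : measurable A -> n1 A = n2 A.
Proof.
apply: (measure_unique (@RGenInftyO.G R) (fun n => `]-oo, n%:R[%classic)).
- exact: RGenInftyO.measurableE.
- move=> _ _ [x ->] [y ->]; exists (Num.min x y); apply/seteqP; split => z /=;
    by rewrite !in_itv/= lt_min => /andP.
- by move=> n; exists n%:R.
- apply/seteqP; split => // z _; exists (Num.trunc z).+1 => //=.
  by rewrite in_itv/= truncnS_gt.
- move=> _ [x ->].
  have xE : [set s | s < x] = `]-oo, x[%classic.
    by apply/seteqP; split => s /=; rewrite in_itv.
  have := agree_ray x; rewrite /agree -indic_bool xE /Rintegral.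
  rewrite !integral_indic// !setIT => E.
  by rewrite -[LHS]fineK ?fin_num_measure//E fineK// fin_num_measure.
- by move=> k; rewrite ltey_eq fin_num_measure.
Qed.

End FourierUniqueness.

(** * Limits of integrals along an ultrafilter, and their densities *)

Section UltraLimits.
Context (R : realType) (U : set_system nat) (UU : UltraFilter U).

Lemma ultra_cvg (u : nat -> R) (M : R) : (forall n, `|u n| <= M) ->
  cvg (u @ U).
Proof.
move=> uM.
have FA : (u @ U) `[- M, M]%classic.
  by rewrite /fmap /=; apply: filterE => n; rewrite /= in_itv/= -ler_norml uM.
have [l [_ lu]] := @segment_compact R (- M) M (u @ U) _ FA.
apply/cvg_ex; exists l => B lB.
have [//|nB] := in_ultra_setVsetC (u @^-1` B) UU.
by have [x []] := lu (~` B) B nB lB.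
Qed.

Lemma ultra_lim_ge0 (u : nat -> R) (M : R) : (forall n, 0 <= u n <= M) ->
  0 <= lim (u @ U) <= M.
Proof.
move=> uM; have cu : cvg (u @ U).
  apply: (@ultra_cvg _ M) => n.
  by have /andP[u0 u1] := uM n; rewrite ger0_norm.
by apply/andP; split; [apply: limr_ge|apply: limr_le] => //;
  apply: nearW => n; case/andP: (uM n).
Qed.

End UltraLimits.

Section DominatedContent.
Context d (T : measurableType d) (R : realType)
  (lam : {finite_measure set T -> \bar R}) (r : set T -> R) (M : R).
Hypothesis r_ge0 : forall B, measurable B -> 0 <= r B.
Hypothesis r_le : forall B, measurable B -> r B <= M * fine (lam B).
Hypothesis rU : forall A B, measurable A -> measurable B -> A `&` B = set0 ->
  r (A `|` B) = r A + r B.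

(** Off the measurable sets nothing is known of [r]; the value [0] there keeps the
    set function nonnegative everywhere. *)
Definition content_measure (B : set T) : \bar R :=
  if pselect (measurable B) then (r B)%:E else 0%E.

Local Notation m := content_measure.

Let mE B : measurable B -> m B = (r B)%:E.
Proof. by move=> mB; rewrite /m; case: pselect. Qed.

Let r0 : r set0 = 0.
Proof.
apply/eqP; rewrite eq_le r_ge0// andbT.
by apply: (le_trans (r_le _)) => //; rewrite measure0 mulr0.
Qed.

Let m0 : m set0 = 0%E. Proof. by rewrite mE// r0. Qed.

Let m_ge0 B : (0 <= m B)%E.
Proof. by rewrite /m; case: pselect => // mB; rewrite lee_fin r_ge0. Qed.

Let r_sum (F : nat -> set T) n : (forall i, measurable (F i)) ->
  trivIset setT F -> r (\big[setU/set0]_(i < n) F i) = \sum_(i < n) r (F i).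
Proof.
move=> mF tF; elim: n => [|n IH]; first by rewrite !big_ord0 r0.
rewrite !big_ord_recr/= rU ?IH//; first exact: bigsetU_measurable.
apply/seteqP; split => // x []; rewrite -bigcup_mkord => -[i /= ilt Fix] Fnx.
have iE := tF i n I I (ex_intro _ x (conj Fix Fnx)).
by move: ilt; rewrite iE ltnn.
Qed.

(* The tails [D n] decrease to the empty set, so [lam (D n)], and with it
   [r (D n)], tends to [0]. *)
Let m_sigma : semi_sigma_additive m.
Proof.
move=> F mF tF mUF.
pose D n := \bigcup_i F i `\` \big[setU/set0]_(i < n) F i.
have mS n : measurable (\big[setU/set0]_(i < n) F i) by exact: bigsetU_measurable.
have mD n : measurable (D n) by exact: measurableD.
have SU n : \big[setU/set0]_(i < n) F i `<=` \bigcup_i F i.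
  by move=> x; rewrite -bigcup_mkord => -[i _ Fix]; exists i.
have split_r n : r (\bigcup_i F i) = \sum_(i < n) r (F i) + r (D n).
  rewrite -r_sum// -rU//; first by rewrite /D setDUK.
  by rewrite /D setDIK.
rewrite mE//.
rewrite (_ : (fun n => _) = (fun n => (\sum_(i < n) r (F i))%:E)); last first.
  by apply/funext => n; rewrite big_mkord -sumEFin; apply: eq_bigr => i _; rewrite mE.
apply: cvg_EFin; first exact: nearW.
rewrite /comp /=.
have DS : fine (lam (D n)) @[n --> \oo] --> (0 : R).
  have D0 : \bigcap_n D n = set0.
    apply/seteqP; split => // x capD; have [[i _ Fix] _] := capD 0%N I.
    have [_] := capD i.+1 I; apply.
    by rewrite -bigcup_mkord; exists i => /=.
  apply: fine_cvg.
  rewrite (_ : 0%:E = lam (\bigcap_n D n)); last by rewrite D0 measure0.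
  apply: nonincreasing_cvg_mu => //.
  - by rewrite ltey_eq fin_num_measure.
  - by rewrite D0.
  - move=> a b ab; apply/subsetPset => x [UFx nFx]; split => //.
    apply: contra_not nFx; rewrite -!bigcup_mkord => -[k /= ka Fkx].
    by exists k => //=; exact: leq_trans ab.
rewrite (_ : (fun n => _) = (fun n => r (\bigcup_i F i) - r (D n))); last first.
  by apply/funext => n; rewrite (split_r n) addrK.
rewrite -[X in _ --> X]subr0; apply: cvgB; first exact: cvg_cst.
apply: (@squeeze_cvgr _ _ _ _ (cst 0) (fun n => M * fine (lam (D n)))).
- by apply: nearW => n; rewrite r_ge0//= r_le.
- exact: cvg_cst.
- by rewrite -(mulr0 M); apply: cvgMr.
Qed.

HB.instance Definition _ := isMeasure.Build _ _ _ m m0 m_ge0 m_sigma.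

Let m_fin : fin_num_fun m.
Proof. by move=> B mB; rewrite mE. Qed.

HB.instance Definition _ := @Measure_isFinite.Build _ _ _ m m_fin.

(** Domination by a finite measure makes a finitely additive set function
    countably additive, so that the Radon--Nikodym theorem applies to it. *)
Lemma dominated_content_density : exists f : T -> R,
  [/\ measurable_fun setT f, forall x, 0 <= f x,
    lam.-integrable setT (EFin \o f) &
    forall B, measurable B -> (r B)%:E = (\int[lam]_(x in B) (f x)%:E)%E].
Proof.
have mlam : m `<< lam.
  apply/null_content_dominatesP => B mB lB0; rewrite /= mE//; congr (_%:E).
  apply/eqP; rewrite eq_le r_ge0// andbT.
  by apply: (le_trans (r_le _)) => //; rewrite lB0 mulr0.
pose f := Radon_Nikodym_SigmaFinite.f m lam.
have fE x : (fine (f x))%:E = f x.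
  by rewrite fineK// Radon_Nikodym_SigmaFinite.f_fin_num.
have iF := Radon_Nikodym_SigmaFinite.f_integrable mlam.
have fE' : EFin \o (fine \o f) = f by apply/funext => x /=.
exists (fine \o f); split.
- by apply/measurable_EFinP; rewrite fE'; exact: measurable_int iF.
- by move=> x; rewrite fine_ge0// Radon_Nikodym_SigmaFinite.f_ge0.
- by rewrite fE'.
- move=> B mB; rewrite -mE// (Radon_Nikodym_SigmaFinite.f_integral mlam)//.
  by apply: eq_integral => x _; rewrite fE.
Qed.

End DominatedContent.

(** * Density measures and product measures *)

(** The proof arguments are what makes this set function a measure; they occur
    in the definition so that the measure structure can be inferred. *)
Definition density_measure d (T : measurableType d) (R : realType)
    (mu : {measure set T -> \bar R}) (f : T -> R)
    (mf : measurable_fun [set: T] f) (f0 : forall x, 0 <= f x) : set T -> \bar R :=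
  fun A => (\int[mu]_(x in A) (f x)%:E)%E.

Section DensityMeasure.
Context d (T : measurableType d) (R : realType) (mu : {measure set T -> \bar R})
  (f : T -> R) (mf : measurable_fun [set: T] f) (f0 : forall x, 0 <= f x).

Local Notation dm := (density_measure mu mf f0).

Let dm0 : dm set0 = 0%E. Proof. exact: integral_set0. Qed.

Let dm_ge0 A : (0 <= dm A)%E.
Proof. by apply: integral_ge0 => x _; rewrite lee_fin. Qed.

Let dm_sigma : semi_sigma_additive dm.
Proof.
apply: (@semi_sigma_additive_nng_induced _ _ _ mu (EFin \o f)) => //.
exact/measurable_EFinP.
Qed.

HB.instance Definition _ := isMeasure.Build _ _ _ dm
  dm0 dm_ge0 dm_sigma.

End DensityMeasure.

Section ProductMeasures.
Context d1 d2 (T1 : measurableType d1) (T2 : measurableType d2) (R : realType).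

Lemma eq_measure_rectangles (m m' : {measure set (T1 * T2) -> \bar R}) :
  (m setT < +oo)%E ->
  (forall A B, measurable A -> measurable B -> m (A `*` B) = m' (A `*` B)) ->
  forall C, measurable C -> m C = m' C.
Proof.
move=> moo mm'.
pose G : set (set (T1 * T2)) := [set A `*` B | A in measurable & B in measurable].
apply: (measure_unique G (fun=> setT)) => //.
- exact: measurable_prod_measurableType.
- move=> _ _ [A mA [B mB <-]] [A' mA' [B' mB' <-]].
  rewrite -setXI; exists (A `&` A'); first exact: measurableI.
  by exists (B `&` B') => //; exact: measurableI.
- by move=> _; exists setT => //; exists setT => //; rewrite setXTT.
- by apply/seteqP; split => // x _; exists 0%N.
- by move=> _ [A mA [B mB <-]]; exact: mm'.
Qed.

Context (lam1 : {finite_measure set T1 -> \bar R})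
  (lam2 : {finite_measure set T2 -> \bar R}).

(** The product measure under a name of its own, which carries the fact that
    it is finite. *)
Definition finite_product : set (T1 * T2) -> \bar R := (lam1 \x lam2)%E.

HB.instance Definition _ := Measure.on finite_product.

Let finite_product_fin : fin_num_fun finite_product.
Proof.
apply: lty_fin_num_fun.
suff : (lam1 setT * lam2 setT < +oo)%E by rewrite -product_measure1E// setXTT.
by rewrite ltey_eq fin_numM// fin_num_measure.
Qed.

HB.instance Definition _ := @Measure_isFinite.Build _ _ _ finite_product
  finite_product_fin.

Lemma measurable_tensor (f : T1 -> R) (g : T2 -> R) :
  measurable_fun setT f -> measurable_fun setT g ->
  measurable_fun setT (fun z : T1 * T2 => f z.1 * g z.2).
Proof. by move=> mf mg; apply: measurable_funM; exact: measurableT_comp. Qed.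

Lemma integral_tensor (f : T1 -> R) (g : T2 -> R) A B :
  measurable A -> measurable B ->
  measurable_fun setT f -> measurable_fun setT g ->
  (forall x, 0 <= f x) -> (forall y, 0 <= g y) ->
  (\int[finite_product]_(z in A `*` B) (f z.1 * g z.2)%:E =
   (\int[lam1]_(x in A) (f x)%:E) * \int[lam2]_(y in B) (g y)%:E)%E.
Proof.
move=> mA mB mf mg f0 g0.
have mfA : measurable_fun setT (fun x => f x * \1_A x).
  by apply: measurable_funM => //; exact: measurable_indic.
have mgB : measurable_fun setT (fun y => g y * \1_B y).
  by apply: measurable_funM => //; exact: measurable_indic.
have fA0 x : 0 <= f x * \1_A x by rewrite mulr_ge0.
have gB0 y : 0 <= g y * \1_B y by rewrite mulr_ge0.
have restr d (T : measurableType d) (m : {measure set T -> \bar R}) (h : T -> R) D :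
    measurable D ->
    (\int[m]_(x in D) (h x)%:E = \int[m]_x (h x * \1_D x)%:E)%E.
  move=> mD; rewrite integral_mkcond; apply: eq_integral => x _.
  by rewrite patchE indicE; case: ifP; rewrite ?mulr1 ?mulr0.
rewrite [LHS](restr _ _ _ _ _ (measurableX mA mB)).
rewrite (restr _ _ lam1 _ _ mA) (restr _ _ lam2 _ _ mB).
transitivity (\int[finite_product]_z
    ((f z.1 * \1_A z.1) * (g z.2 * \1_B z.2))%:E)%E.
  apply: eq_integral => -[x y] _ /=; congr (_%:E).
  have -> : \1_(A `*` B) (x, y) = \1_A x * \1_B y :> R.
    rewrite !indicE -natrM mulnb; congr (_ %:R); congr nat_of_bool.
    by apply/idP/andP => [/set_mem[/= ? ?]|[/set_mem ? /set_mem ?]];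
      [split; apply/mem_set|apply/mem_set].
  ring.
rewrite fubini_tonelli1; last 2 first.
- by apply/measurable_EFinP; exact: measurable_tensor mfA mgB.
- by move=> z; rewrite lee_fin mulr_ge0.
rewrite /fubini_F/=.
transitivity (\int[lam1]_x ((f x * \1_A x)%:E *
    \int[lam2]_y (g y * \1_B y)%:E))%E.
  apply: eq_integral => x _; under eq_integral do rewrite EFinM.
  rewrite ge0_integralZl//.
  - exact/measurable_EFinP.
  - by move=> y _; rewrite lee_fin.
  - by rewrite lee_fin.
rewrite ge0_integralZr//; first exact/measurable_EFinP.
- by move=> x _; rewrite lee_fin.
- by apply: integral_ge0 => y _; rewrite lee_fin.
Qed.

End ProductMeasures.

(** * Weak limits along an ultrafilter *)

Section UltraWeakLimits.
Context (R : realType) (U : set_system nat) (UU : UltraFilter U).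

(** Convergence of the integrals over every measurable set: for bounded
    sequences this is weak-star convergence along the ultrafilter. *)
Definition ultra_weak d (T : measurableType d)
    (lam : {finite_measure set T -> \bar R}) (w_ : nat -> T -> R) (f : T -> R) :=
  lam.-integrable setT (EFin \o f) /\
  forall B, measurable B ->
    \int[lam]_(x in B) w_ n x @[n --> U] --> \int[lam]_(x in B) f x.

Section Density.
Context d (T : measurableType d) (lam : {finite_measure set T -> \bar R}).

Lemma ultra_weak_lin (w_ v_ : nat -> T -> R) (f g : T -> R) (a b : R) :
  (forall n, bounded_measurable (w_ n)) -> (forall n, bounded_measurable (v_ n)) ->
  ultra_weak lam w_ f -> ultra_weak lam v_ g ->
  ultra_weak lam (fun n x => a * w_ n x + b * v_ n x) (fun x => a * f x + b * g x).
Proof.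
move=> bw bv [iF wf] [iG vg].
have iz (c : R) h D : measurable D -> lam.-integrable D (EFin \o h) ->
    lam.-integrable D (EFin \o (fun x => c * h x)).
  move=> mD ih; have := integrableZl mD c ih; apply: eq_integrable => //.
split.
  have := integrableD measurableT (iz a _ _ measurableT iF) (iz b _ _ measurableT iG).
  exact: eq_integrable.
move=> B mB.
have iFB := integrableS measurableT mB (@subsetT _ _) iF.
have iGB := integrableS measurableT mB (@subsetT _ _) iG.
rewrite RintegralD//; [|exact: iz..].
rewrite !RintegralZl//.
rewrite (_ : (fun n => _) = (fun n => a * (\int[lam]_(x in B) w_ n x) +
    b * (\int[lam]_(x in B) v_ n x))); last first.
  apply/funext => n.
  have iw := bounded_measurable_integrable lam mB (bw n).
  have iv := bounded_measurable_integrable lam mB (bv n).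
  by rewrite RintegralD//; [rewrite !RintegralZl|exact: iz..].
by apply: cvgD; apply: cvgMr; [exact: wf|exact: vg].
Qed.

Context (w_ : nat -> T -> R) (M : R).
Hypothesis mw : forall n, measurable_fun setT (w_ n).
Hypothesis w0 : forall n x, 0 <= w_ n x.
Hypothesis wM : forall n x, w_ n x <= M.

Let bw n : bounded_measurable (w_ n).
Proof. by split => //; exists M => x; rewrite ger0_norm. Qed.

Let int_bound n B : measurable B ->
  0 <= \int[lam]_(x in B) w_ n x <= M * fine (lam B).
Proof.
move=> mB; rewrite Rintegral_ge0//= -Rintegral_cst//.
apply: le_Rintegral => //; first exact: bounded_measurable_integrable.
by apply: bounded_measurable_integrable => //; exact: bounded_measurable_cst.
Qed.

Let int_cvg B : measurable B -> cvg (\int[lam]_(x in B) w_ n x @[n --> U]).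
Proof.
move=> mB; apply: (@ultra_cvg _ _ _ _ (M * fine (lam B))) => n.
by have /andP[h0 h1] := int_bound n mB; rewrite ger0_norm.
Qed.

Lemma ultra_weak_density :
  exists2 f : T -> R,
    (measurable_fun setT f /\ forall x, 0 <= f x) & ultra_weak lam w_ f.
Proof.
pose r B := lim (\int[lam]_(x in B) w_ n x @[n --> U]).
have [||| f [mf f0 iF rf]] := @dominated_content_density _ _ _ lam r M.
- by move=> B mB; have /andP[] := ultra_lim_ge0 UU (fun n => int_bound n mB).
- by move=> B mB; have /andP[] := ultra_lim_ge0 UU (fun n => int_bound n mB).
- move=> A B mA mB AB.
  have E : (fun n => \int[lam]_(x in A `|` B) w_ n x) =
      (fun n => \int[lam]_(x in A) w_ n x + \int[lam]_(x in B) w_ n x).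
    apply/funext => n; rewrite Rintegral_setU//.
    + by apply: bounded_measurable_integrable => //; exact: measurableU.
    + by apply/disj_setPS; rewrite AB.
  by rewrite /r E limD; [|exact: (int_cvg mA)|exact: (int_cvg mB)].
- exists f => //; split => // B mB.
  rewrite [X in _ --> X](_ : _ = r B); first exact: int_cvg.
  by rewrite /Rintegral -rf.
Qed.

End Density.

Section Product.
Context d1 d2 (T1 : measurableType d1) (T2 : measurableType d2)
  (lam1 : {finite_measure set T1 -> \bar R})
  (lam2 : {finite_measure set T2 -> \bar R}).
Local Notation lam12 := (finite_product lam1 lam2).

Lemma integrable_tensor (f : T1 -> R) (g : T2 -> R) :
  (forall x, 0 <= f x) -> (forall y, 0 <= g y) ->
  lam1.-integrable setT (EFin \o f) -> lam2.-integrable setT (EFin \o g) ->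
  lam12.-integrable setT (EFin \o (fun z => f z.1 * g z.2)).
Proof.
move=> f0 g0 iF iG.
have mf : measurable_fun setT f by apply/measurable_EFinP; exact: measurable_int iF.
have mg : measurable_fun setT g by apply/measurable_EFinP; exact: measurable_int iG.
apply/integrableP; split; first by apply/measurable_EFinP; exact: measurable_tensor.
under eq_integral do rewrite /= ger0_norm ?mulr_ge0//.
rewrite -setXTT integral_tensor// ltey_eq fin_numM//.
- exact: integrable_fin_num iF.
- exact: integrable_fin_num iG.
Qed.

Lemma Rintegral_tensor (f : T1 -> R) (g : T2 -> R) A B :
  measurable A -> measurable B ->
  (forall x, 0 <= f x) -> (forall y, 0 <= g y) ->
  lam1.-integrable setT (EFin \o f) -> lam2.-integrable setT (EFin \o g) ->
  \int[lam12]_(z in A `*` B) (f z.1 * g z.2) =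
  (\int[lam1]_(x in A) f x) * \int[lam2]_(y in B) g y.
Proof.
move=> mA mB f0 g0 iF iG.
have mf : measurable_fun setT f by apply/measurable_EFinP; exact: measurable_int iF.
have mg : measurable_fun setT g by apply/measurable_EFinP; exact: measurable_int iG.
rewrite /Rintegral integral_tensor// fineM//.
- by apply: integrable_fin_num => //; exact: integrableS iF.
- by apply: integrable_fin_num => //; exact: integrableS iG.
Qed.

(** Weak limits along an ultrafilter are multiplicative on product functions:
    along the ultrafilter the products have some weak limit, whose integrals
    over rectangles are those of the product of the limits. *)
Lemma ultra_weak_tensor (w_ : nat -> T1 -> R) (v_ : nat -> T2 -> R)
    (f : T1 -> R) (g : T2 -> R) (M : R) :
  (forall n, measurable_fun setT (w_ n)) -> (forall n, measurable_fun setT (v_ n)) ->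
  (forall n x, 0 <= w_ n x <= M) -> (forall n y, 0 <= v_ n y <= M) ->
  (forall x, 0 <= f x) -> (forall y, 0 <= g y) ->
  ultra_weak lam1 w_ f -> ultra_weak lam2 v_ g ->
  ultra_weak lam12 (fun n z => w_ n z.1 * v_ n z.2) (fun z => f z.1 * g z.2).
Proof.
move=> mw mv wM vM f0 g0 [iF wf] [iG vg].
have mf : measurable_fun setT f by apply/measurable_EFinP; exact: measurable_int iF.
have mg : measurable_fun setT g by apply/measurable_EFinP; exact: measurable_int iG.
have w0 n x : 0 <= w_ n x by case/andP: (wM n x).
have v0 n y : 0 <= v_ n y by case/andP: (vM n y).
have iw n : lam1.-integrable setT (EFin \o w_ n).
  apply: bounded_measurable_integrable => //; split => //; exists M => x.
  by rewrite ger0_norm//; case/andP: (wM n x).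
have iv n : lam2.-integrable setT (EFin \o v_ n).
  apply: bounded_measurable_integrable => //; split => //; exists M => x.
  by rewrite ger0_norm//; case/andP: (vM n x).
have [||| h [mh h0] [iH wh]] :=
  @ultra_weak_density _ _ lam12 (fun n z => w_ n z.1 * v_ n z.2) (M * M).
- by move=> n; exact: measurable_tensor.
- by move=> n z; rewrite mulr_ge0.
- by move=> n z; apply: ler_pM => //; [case/andP: (wM n z.1)|case/andP: (vM n z.2)].
have ifg := integrable_tensor f0 g0 iF iG.
have fg0 z : 0 <= f z.1 * g z.2 by rewrite mulr_ge0.
split=> // C mC.
suff -> : \int[lam12]_(z in C) (f z.1 * g z.2) = \int[lam12]_(z in C) h z.
  exact: wh.
rewrite /Rintegral; congr fine.
suff : density_measure lam12 (measurable_tensor mf mg) fg0 C =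
    density_measure lam12 mh h0 C by [].
apply: eq_measure_rectangles => //.
  rewrite /= /density_measure; case/integrableP: ifg => _.
  by apply: le_lt_trans; apply: ge0_le_integral => //= [z _|||z _];
    rewrite ?lee_fin ?ger0_norm//; apply/measurable_EFinP;
    first [exact: measurable_tensor |
           apply: measurableT_comp => //; exact: measurable_tensor].
move=> A B mA mB; rewrite /= /density_measure.
have E : \int[lam12]_(z in A `*` B) (f z.1 * g z.2) = \int[lam12]_(z in A `*` B) h z.
  rewrite Rintegral_tensor//.
  have c1 : \int[lam12]_(z in A `*` B) (w_ n z.1 * v_ n z.2) @[n --> U] -->
      (\int[lam1]_(x in A) f x) * \int[lam2]_(y in B) g y.
    rewrite (_ : (fun n => _) =
        (fun n => (\int[lam1]_(x in A) w_ n x) * \int[lam2]_(y in B) v_ n y)).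
      by apply: cvgM; [exact: wf|exact: vg].
    by apply/funext => n; rewrite Rintegral_tensor.
  by apply: (cvg_unique _ c1); [exact: Rhausdorff|apply: wh; exact: measurableX].
have mAB := measurableX mA mB.
have fin (k : T1 * T2 -> R) : lam12.-integrable setT (EFin \o k) ->
    (\int[lam12]_(z in A `*` B) (k z)%:E)%E \is a fin_num.
  by move=> ik; apply: integrable_fin_num => //; exact: integrableS ik.
by rewrite -[LHS]fineK ?fin//; move: E; rewrite /Rintegral => ->; rewrite fineK// fin.
Qed.

End Product.
End UltraWeakLimits.

(** * Real analytic functions *)

Section RealAnalytic.
Context (R : realType).
Implicit Types (f g : R -> R) (a : nat -> R).

Definition power_expansion f (x0 r : R) a := forall x, `|x - x0| < r ->
  \sum_(k < n) a k * (x - x0) ^+ k @[n --> \oo] --> f x.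

Definition ranalytic f := forall x0 : R, exists2 r : R, 0 < r &
  exists a, power_expansion f x0 r a.

Lemma ranalytic_shift f c : ranalytic f -> ranalytic (fun x => f (c + x)).
Proof.
move=> af x0; have [r r0 [a fa]] := af (c + x0); exists r => //; exists a => x.
have -> : x - x0 = (c + x) - (c + x0) by ring.
exact: fa.
Qed.

Lemma ranalyticN f : ranalytic f -> ranalytic (fun x => f (- x)).
Proof.
move=> af x0; have [r r0 [a fa]] := af (- x0); exists r => //.
exists (fun k => a k * (-1) ^+ k) => x xr.
rewrite (_ : (fun n => _) = (fun n => \sum_(k < n) a k * (- x - - x0) ^+ k)).
  apply: fa; rewrite -normrN; have -> : - (- x - - x0) = x - x0 by ring.
  exact: xr.
apply/funext => n; apply: eq_bigr => k _.
by rewrite -mulrA -exprMn; congr (_ * _ ^+ _); ring.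
Qed.

Lemma ranalytic_lin f g (c e : R) : ranalytic f -> ranalytic g ->
  ranalytic (fun x => c * f x + e * g x).
Proof.
move=> af ag x0; have [r r0 [a fa]] := af x0; have [s s0 [b gb]] := ag x0.
exists (Num.min r s); first by rewrite lt_min r0.
exists (fun k => c * a k + e * b k) => x; rewrite lt_min => /andP[xr xs].
rewrite (_ : (fun n => _) = (fun n => c * (\sum_(k < n) a k * (x - x0) ^+ k) +
   e * (\sum_(k < n) b k * (x - x0) ^+ k))).
  by apply: cvgD; apply: cvgMr; [exact: fa|exact: gb].
apply/funext => n; rewrite !mulr_sumr -big_split/=; apply: eq_bigr => k _; ring.
Qed.

Lemma sum_geometric_half_le (q : R) m n : 0 <= q <= 1 / 2 ->
  \sum_(m <= k < n) q ^+ k <= 2 * q ^+ m.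
Proof.
move=> /andP[q0 q1]; have [nm|mn] := leqP n m.
  by rewrite big_geq// mulr_ge0// exprn_ge0.
rewrite -(subnKC (ltnW mn)); move: (n - m)%N => {mn}p.
suff : \sum_(m <= k < m + p) q ^+ k + 2 * q ^+ (m + p) <= 2 * q ^+ m.
  by have := exprn_ge0 (m + p) q0; lra.
elim: p => [|p IH].
  by rewrite addn0 big_geq// add0r; have := exprn_ge0 m q0; lra.
rewrite addnS big_nat_recr ?leq_addr//= exprS.
have := exprn_ge0 (m + p) q0; move: IH; set y := q ^+ (m + p) => IH y0.
have : q * y <= 1 / 2 * y by rewrite ler_wpM2r.
by lra.
Qed.

(** Convergence at distance [2 rho] bounds the coefficients geometrically, so
    that the remainders of the expansion are controlled near the centre. *)
Lemma power_expansion_remainder f x0 r a : 0 < r -> power_expansion f x0 r a ->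
  exists2 rho, 0 < rho & forall m, exists2 C, 0 <= C & forall t, `|t| <= rho ->
    `|f (x0 + t) - \sum_(k < m) a k * t ^+ k| <= C * `|t| ^+ m.
Proof.
move=> r0 fa.
set s := r / 2; have s0 : 0 < s by rewrite divr_gt0.
have sr : `|x0 + s - x0| < r by rewrite addrC addKr gtr0_norm// /s; lra.
have [B aB] : exists B, forall k, `|a k| * s ^+ k <= B.
  have : bounded_fun (fun k => a k * s ^+ k).
    apply: cvg_series_bounded; apply/cvg_ex; exists (f (x0 + s)).
    have := fa _ sr; rewrite [x0 + s]addrC addrK.
    by rewrite (_ : (fun n => _) = series (fun k => a k * s ^+ k))//;
      apply/funext => n; rewrite seriesEord.
  move=> [M [_ /(_ (M + 1))]]; rewrite ltrDl ltr01 => /(_ isT) h.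
  exists (M + 1) => k; have := h k I.
  by rewrite /= normrM [`|s ^+ k|]ger0_norm// exprn_ge0// ltW.
have B0 : 0 <= B by apply: le_trans (aB 0%N); rewrite mulr_ge0.
exists (s / 2); first by rewrite divr_gt0.
move=> m; exists (2 * B / s ^+ m).
  by rewrite divr_ge0 ?mulr_ge0// exprn_ge0// ltW.
move=> t ts.
have tr : `|x0 + t - x0| < r by rewrite addrC addKr; move: ts; rewrite /s; lra.
have c := fa _ tr; rewrite [x0 + t]addrC addrK in c.
have q01 : 0 <= `|t| / s <= 1 / 2.
  apply/andP; split; first by rewrite divr_ge0// ltW.
  by rewrite ler_pdivrMr//; lra.
have cB : `|\sum_(k < n) a k * t ^+ k - \sum_(k < m) a k * t ^+ k| @[n --> \oo] -->
    `|f (t + x0) - \sum_(k < m) a k * t ^+ k|.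
  by apply: cvg_norm; apply: cvgB => //; exact: cvg_cst.
rewrite [x0 + t]addrC -(cvg_lim (@Rhausdorff R) cB).
apply: limr_le; first by apply/cvg_ex; eexists; exact: cB.
near=> n; have mn : (m <= n)%N by near: n; exact: nbhs_infty_ge.
rewrite -!(big_mkord xpredT (fun k => a k * t ^+ k)).
rewrite (@big_cat_nat _ _ _ m)//= addrAC subrr add0r.
apply: (le_trans (ler_norm_sum _ _ _)).
apply: (@le_trans _ _ (B * \sum_(m <= k < n) (`|t| / s) ^+ k)).
  rewrite mulr_sumr; apply: ler_sum => k _.
  rewrite normrM normrX expr_div_n mulrA ler_pdivlMr ?exprn_gt0//.
  by rewrite mulrAC ler_wpM2r// exprn_ge0.
apply: (le_trans (ler_wpM2l B0 (sum_geometric_half_le m n q01))).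
by rewrite expr_div_n le_eqVlt; apply/orP; left; apply/eqP; ring.
Unshelve. all: by end_near. Qed.

(** Near the centre the first nonzero term of the expansion dominates the
    remainder. *)
Lemma analytic_isolated_zeros f x0 : ranalytic f ->
  (exists2 e, 0 < e & forall t, `|t| < e -> f (x0 + t) = 0) \/
  (exists2 e, 0 < e & forall t, 0 < `|t| < e -> f (x0 + t) != 0).
Proof.
move=> /(_ x0)[r r0 [a fa]].
have [rho rho0 fC] := power_expansion_remainder r0 fa.
have [a0|/existsNP/cid[k ak]] := pselect (forall k, a k = 0).
  left; exists (Num.min rho r); first by rewrite lt_min rho0.
  move=> t; rewrite lt_min => /andP[_ tr].
  have := fa (x0 + t); rewrite addrC addKr => /(_ tr) c.
  apply/esym; apply: (cvg_unique _ _ c); first exact: Rhausdorff.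
  rewrite (_ : (fun n => _) = cst 0); first exact: cvg_cst.
  by apply/funext => n; apply: big1 => i _; rewrite a0 mul0r.
right.
have exk : exists k, a k != 0 by exists k; apply/eqP.
pose m := ex_minn exk; have [am mmin] : a m != 0 /\ forall j, (j < m)%N -> a j = 0.
  rewrite /m; case: ex_minnP => n an nmin; split => // j jn.
  by apply/eqP; apply: contraTT jn => /nmin; rewrite -leqNgt.
have [C C0 fCm] := fC m.+1.
exists (Num.min rho (`|a m| / (C + 1))).
  by rewrite lt_min rho0 divr_gt0 ?normr_gt0//; lra.
move=> t; rewrite lt_min => /and3P[t0 trho ta].
apply/negP => /eqP ft0; have := fCm t (ltW trho).
rewrite ft0 big_ord_recr/= big1 ?add0r ?sub0r; last first.
  by move=> i _; rewrite mmin ?mul0r.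
rewrite normrN normrM normrX exprS mulrA ler_pM2r ?exprn_gt0//.
move: ta; rewrite ltr_pdivlMr; last by lra.
nra.
Qed.

(** The points near which [f] vanishes form an open set; it is closed because a
    limit of such points is not an isolated zero. *)
Lemma analytic_identity f z : ranalytic f ->
  (forall e, 0 < e -> exists t, 0 < `|t| < e /\ f (z + t) = 0) ->
  forall x, f x = 0.
Proof.
move=> af facc.
pose S := [set x | exists2 e, 0 < e & forall t, `|t| < e -> f (x + t) = 0].
have accS y : (forall e, 0 < e -> exists t, 0 < `|t| < e /\ f (y + t) = 0) -> S y.
  move=> yacc; have [//|[e e0 fe]] := analytic_isolated_zeros y af.
  by have [t [te ft]] := yacc _ e0; have := fe t te; rewrite ft eqxx.
have Sf x : S x -> f x = 0.
  by move=> [e e0 fe]; rewrite -[x]addr0 fe// normr0.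
have cT : connected [set: R] by apply/connected_intervalP.
move=> x; apply: Sf; suff -> : S = setT by [].
apply: cT.
- by exists z; exact: accS.
- exists S; last by rewrite setTI.
  rewrite openE => y [e e0 fe]; apply/nbhs_ballP; exists (e / 2) => /=.
    by rewrite divr_gt0.
  move=> y' /=; rewrite /ball/= => yy'; exists (e / 2); first by rewrite divr_gt0.
  move=> t te; have -> : y' + t = y + ((y' - y) + t) by ring.
  apply: fe; apply: le_lt_trans (ler_normD _ _) _; rewrite distrC in yy'; lra.
- exists S; last by rewrite setTI.
  move=> y clSy; apply: accS => e e0.
  have [y' [[e' e'0 fe'] yy']] := clSy _ (nbhsx_ballx y (e / 2) (divr_gt0 e0 (ltr0n _ 2))).
  rewrite /ball/= in yy'.
  pose d := Num.min (e' / 2) (e / 4).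
  have d0 : 0 < d by rewrite lt_min !divr_gt0.
  have de' : d <= e' / 2 by rewrite ge_min lexx.
  have de : d <= e / 4 by rewrite ge_min lexx orbT.
  have [t0 t0n td] : exists2 t0, y' - y + t0 != 0 & `|t0| <= d.
    have [E|] := eqVneq (y' - y) 0.
      by exists d; [rewrite E add0r gt_eqF|rewrite gtr0_norm].
    by exists 0; [rewrite addr0|rewrite normr0 ltW].
  exists (y' - y + t0); split.
    rewrite normr_gt0 t0n/=; apply: le_lt_trans (ler_normD _ _) _.
    by rewrite distrC in yy'; lra.
  have -> : y + (y' - y + t0) = y' + t0 by ring.
  by apply: fe'; lra.
Qed.

(** The quadratic remainder gives differentiability at the centre. *)
Lemma ranalytic_derivable f : ranalytic f -> forall x, derivable f x 1.
Proof.
move=> af x0; have [r r0 [a fa]] := af x0.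
have [rho rho0 fC] := power_expansion_remainder r0 fa.
have [C C0 fC2] := fC 2%N.
have f0 : f x0 = a 0%N.
  have [C1 C10 fC1] := fC 1%N.
  have := fC1 0; rewrite normr0 => /(_ (ltW rho0)).
  rewrite expr1 mulr0 addr0 big_ord1 expr0 mulr1 normr_le0 subr_eq0 => /eqP//.
apply/cvg_ex; exists (a 1%N); apply/cvgrPdist_le => e e0.
near=> h.
have h0 : h != 0 by near: h; exact: nbhs_dnbhs_neq.
have hrho : `|h| <= rho by near: h; exact: dnbhs0_le.
have hC : `|h| <= e / (C + 1).
  by near: h; apply: dnbhs0_le; rewrite divr_gt0//; lra.
have := fC2 h hrho; rewrite 2!big_ord_recr big_ord0/= add0r expr0 mulr1 expr1 -f0.
rewrite [x0 + h]addrC => H.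
have hn : 0 < `|h| by rewrite normr_gt0.
rewrite -(ler_pM2r hn) -normrM; apply: (@le_trans _ _ (C * `|h| ^+ 2)).
  rewrite (_ : _ * h = - (f (h + x0) - (f x0 + a 1%N * h))) ?normrN//.
  by rewrite /GRing.scale/= mulr1; field.
move: hC; rewrite ler_pdivlMr; last by lra.
rewrite expr2 mulrA ler_pM2r// => hC; nra.
Unshelve. all: by end_near. Qed.

End RealAnalytic.

(** * Atomless measures and accumulation points *)

Section MassPoints.
Context (R : realType) (lam : {finite_measure set R -> \bar R}).

(** Otherwise the rational intervals meeting [B] in a null set would cover it. *)
Lemma mass_point B : measurable B -> lam B != 0%E ->
  exists z, forall e, 0 < e -> lam (B `&` ball z e) != 0%E.
Proof.
move=> mB; apply: contra_neqP => /forallNP nz.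
have null z : exists2 e, 0 < e & lam (B `&` ball z e) = 0%E.
  have /existsNP[e /not_implyP[e0 /negP]] := nz z.
  by rewrite negbK => /eqP; exists e.
pose J (q : rat * rat) : set R := B `&` `]ratr q.1, ratr q.2[%classic.
pose F n := if unpickle n is Some q then
  (if lam (J q) == 0%E then J q else set0) else set0.
have mJ q : measurable (J q) by exact: measurableI.
have F0 n : lam.-negligible (F n).
  rewrite /F; case: unpickle => [q|]; last exact: negligible_set0.
  by case: eqP => [q0|_]; [exact/negligibleP|exact: negligible_set0].
apply/negligibleP => //; apply: negligibleS (negligible_bigcup F0).
move=> x Bx; have [e e0 xe] := null x.
have [q1] : exists q : rat, ratr q \in `]x - e, x[ by apply: rat_in_itvoo; rewrite gtrBl.
have [q2] : exists q : rat, ratr q \in `]x, x + e[ by apply: rat_in_itvoo; rewrite ltrDl.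
rewrite !in_itv/= => /andP[h1 h2] /andP[h3 h4].
exists (pickle (q1, q2)); first exact: I.
rewrite /F pickleK.
have -> : lam (J (q1, q2)) == 0%E.
  rewrite -measure_le0 -xe le_measure ?inE//.
    by apply: measurableI => //; exact: measurable_ball.
  move=> y [By /=]; rewrite in_itv/= => /andP[y1 y2]; split => //.
  rewrite /ball/= ltr_norml; apply/andP; split; lra.
by split => //=; rewrite in_itv/= h1 h4.
Qed.

Hypothesis clam : continuous_measure lam.

Lemma finite_negligible A : finite_set A -> lam.-negligible A.
Proof.
move=> /finite_seqP[s ->]; elim: s => [|x s IH].
  by apply: negligibleS (negligible_set0 _) => x.
apply: (@negligibleS _ _ _ _ ([set x] `|` [set` s])).
  by move=> y; rewrite /= inE => /orP[/eqP->|ys]; [left|right].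
apply: negligibleU => //.
by apply/negligibleP; [exact: measurable_set1|exact: clam].
Qed.

Lemma mass_point_infinite B : measurable B -> lam B != 0%E ->
  exists z, forall e, 0 < e -> infinite_set (B `&` ball z e).
Proof.
move=> mB /(mass_point mB)[z zB]; exists z => e e0 /finite_negligible.
have mBz : measurable (B `&` ball z e).
  by apply: measurableI => //; exact: measurable_ball.
by move/(negligibleP _ mBz); apply/eqP; exact: zB.
Qed.

(** A set of positive mass of an atomless measure has an accumulation point. *)
Lemma analytic_identity_measure f B : ranalytic f -> measurable B ->
  lam B != 0%E -> (forall x, B x -> f x = 0) -> forall x, f x = 0.
Proof.
move=> af mB /(mass_point_infinite mB)[z zB] fB.
apply: (@analytic_identity _ _ z) => // e e0.
have /infinite_setN0[y [[By zy] /eqP yz]] :=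
  infinite_setD (zB e e0) (finite_set1 z).
exists (y - z); rewrite [z + _]addrC subrK fB//; split => //.
by rewrite normr_gt0 subr_eq0 yz/= distrC.
Qed.

End MassPoints.

Section Overlaps.
Context (R : realType).

(** If all overlaps were null, [n] of the sets would have union of mass at least
    [n * delta]. *)
Lemma overlapping_pair d (T : measurableType d) (m : {finite_measure set T -> \bar R})
    (F : nat -> set T) (delta : R) : (forall n, measurable (F n)) -> 0 < delta ->
  (forall n, (delta%:E <= m (F n))%E) ->
  exists i j, i <> j /\ m (F i `&` F j) != 0%E.
Proof.
move=> mF d0 dF; apply: contrapT => /forallNP nF.
have F0 i j : i <> j -> m (F i `&` F j) = 0%E.
  move=> ij; apply/eqP; apply: contrapT => /negP h.
  by have /forallNP/(_ j) := nF i; apply.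
have mU n : measurable (\big[setU/set0]_(i < n) F i) by exact: bigsetU_measurable.
have big n : ((n%:R * delta)%:E <= m (\big[setU/set0]_(i < n) F i))%E.
  elim: n => [|n IH]; first by rewrite mul0r big_ord0 measure0.
  rewrite big_ord_recr/=.
  have I0 : (m : {measure set T -> \bar R})
      (\big[setU/set0]_(i < n) F i `&` F n) = 0%E.
    apply/negligibleP; first exact: measurableI.
    rewrite -bigcup_mkord setI_bigcupl bigcup_mkcond.
    apply: negligible_bigcup => k; case: ifPn => [/set_mem/= kn|_].
      by apply/negligibleP; [exact: measurableI|apply: F0; apply/eqP; rewrite ltn_eqF].
    exact: negligible_set0.
  have Foo : (m (F n) < +oo)%E by rewrite ltey_eq fin_num_measure.
  rewrite (measureUfinr (mU n) (mF n) Foo).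
  rewrite I0 sube0 -natr1 mulrDl mul1r EFinD; apply: leeD; [exact: IH|exact: dF].
have mTfin : m setT \is a fin_num by rewrite fin_num_measure.
have [n nM] : exists n : nat, fine (m setT) < n%:R * delta.
  exists (Num.trunc (fine (m setT) / delta)).+1.
  by rewrite -ltr_pdivrMr// truncnS_gt.
have : ((n%:R * delta)%:E <= m setT)%E.
  by apply: le_trans (big n) _; apply: le_measure; rewrite ?inE.
by rewrite -(fineK mTfin) lee_fin leNgt nM.
Qed.

(** A positive mass of points [x] share a lower bound on the mass of [F x];
    infinitely many of them are close together, and overlap by pigeonhole. *)
Lemma close_overlapping_pair (lam : {finite_measure set R -> \bar R})
    d (T : measurableType d) (m : {finite_measure set T -> \bar R})
    (F : R -> set T) (G : set R) : continuous_measure lam ->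
  measurable G -> lam G != 0%E ->
  (forall x, measurable (F x)) -> measurable_fun setT (m \o F) ->
  (forall x, G x -> m (F x) != 0%E) ->
  forall e, 0 < e -> exists x x',
    [/\ G x, G x', 0 < `|x' - x| < e & m (F x `&` F x') != 0%E].
Proof.
move=> clam mG G0 mF mmF FG e e0.
pose Gk k := G `&` [set x | (k.+1%:R^-1%:E <= m (F x))%E].
have mGk k : measurable (Gk k).
  apply: measurableI => //; rewrite -[X in measurable X]setTI.
  by apply: emeasurable_fun_c_infty.
have [k Gk0] : exists k, lam (Gk k) != 0%E.
  apply: contrapT => /forallNP nk; move/negP: G0; apply; apply/eqP.
  apply/negligibleP => //.
  apply: (@negligibleS _ _ _ _ (\bigcup_k Gk k)).
    move=> x Gx; have mx : m (F x) \is a fin_num by rewrite fin_num_measure.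
    have x0 : 0 < fine (m (F x)).
      by rewrite fine_gt0// lt0e FG// measure_ge0/= ltey_eq mx.
    exists (Num.trunc (fine (m (F x)))^-1) => //; split => //=.
    rewrite -(fineK mx) lee_fin invf_ple ?posrE//.
    by rewrite ltW// truncnS_gt.
  apply: negligible_bigcup => k; apply/negligibleP; first exact: mGk.
  by apply/eqP; apply: contrapT => /negP; exact: nk.
have [z zG] := mass_point_infinite clam (mGk k) Gk0.
have /infiniteP/ppcard_leP[u] := zG (e / 2) (divr_gt0 e0 (ltr0n _ 2)).
have uG n : (Gk k `&` ball z (e / 2)) (u n) by exact: funS.
have [||| i [j [ij Fij]]] := @overlapping_pair _ _ m (F \o u) (k.+1%:R^-1).
- by move=> n; exact: mF.
- by rewrite invr_gt0.
- by move=> n; have [[]] := uG n.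
exists (u i), (u j); have [[Gi _] bi] := uG i; have [[Gj _] bj] := uG j.
split => //; apply/andP; split.
  rewrite normr_gt0 subr_eq0; apply/eqP => uji.
  by apply: ij; apply/esym; apply: (@inj _ _ _ u) => //; rewrite inE.
rewrite /ball/= in bi bj; have -> : u j - u i = (z - u i) - (z - u j) by ring.
by apply: le_lt_trans (ler_normB _ _) _; lra.
Qed.

End Overlaps.

(** * Weak-star limits and absolutely continuous measures *)

(** Restriction and image are combined so that the proof arguments let the result
    be inferred to be a finite measure. *)
Definition image_measure d d' (T : measurableType d) (T' : measurableType d')
    (R : realType) (m : {finite_measure set T -> \bar R}) (f : T -> T')
    (mf : measurable_fun [set: T] f) (D : set T) (mD : measurable D) :
    set T' -> \bar R :=
  fun A => m (f @^-1` A `&` D).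

Section ImageMeasure.
Context d d' (T : measurableType d) (T' : measurableType d') (R : realType)
  (m : {finite_measure set T -> \bar R}) (f : T -> T')
  (mf : measurable_fun [set: T] f) (D : set T) (mD : measurable D).

Local Notation im := (image_measure m mf mD).

Let mpre A : measurable A -> measurable (f @^-1` A).
Proof. by move=> mA; rewrite -[X in measurable X]setTI; exact: mf. Qed.

Let im0 : im set0 = 0%E.
Proof. by rewrite /image_measure preimage_set0 set0I measure0. Qed.

Let im_ge0 A : (0 <= im A)%E. Proof. exact: measure_ge0. Qed.

Let im_sigma : semi_sigma_additive im.
Proof.
move=> F mF tF mUF; rewrite /image_measure preimage_bigcup setI_bigcupl.
apply: measure_semi_sigma_additive.
- by move=> n; apply: measurableI => //; exact: mpre.
- apply: trivIset_setIr; apply/trivIsetP => /= i j _ _ ij; rewrite -preimage_setI.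
  by move/trivIsetP : tF => /(_ _ _ _ _ ij) ->//; rewrite preimage_set0.
- by rewrite -setI_bigcupl -preimage_bigcup; apply: measurableI => //; exact: mpre.
Qed.

HB.instance Definition _ := isMeasure.Build _ _ _ im im0 im_ge0 im_sigma.

Let im_fin : fin_num_fun im.
Proof.
by move=> A mA; rewrite fin_num_measure//; apply: measurableI => //; exact: mpre.
Qed.

HB.instance Definition _ := @Measure_isFinite.Build _ _ _ im im_fin.

Lemma Rintegral_image (g : T' -> R) : bounded_measurable g ->
  \int[im]_y g y = \int[m]_(x in D) g (f x).
Proof.
move=> bg; rewrite /Rintegral; congr fine.
have bgf : bounded_measurable (g \o f).
  case: bg => mg [M gM]; split; first exact: measurableT_comp.
  by exists M => x; exact: gM.
have -> : (\int[im]_y (g y)%:E = \int[pushforward (mrestr m mD) f]_y (g y)%:E)%E by [].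
rewrite (@integral_pushforward _ _ _ _ _ f mf (mrestr m mD) setT (EFin \o g))//; last 2 first.
- by apply/measurable_EFinP; case: bg.
- by rewrite preimage_setT; exact: bounded_measurable_integrable.
rewrite preimage_setT.
rewrite (@negligible_integral _ _ _ (mrestr m mD) setT (~` D))//=.
- rewrite setTD setCK; apply: eq_measure_integral => A mA AD.
  by rewrite /mrestr; congr (m _); exact: setIidl.
- exact: measurableC.
- exact: (@bounded_measurable_integrable _ _ _ (mrestr m mD)).
- by rewrite /mrestr setICl measure0.
Qed.

End ImageMeasure.

Section AbsolutelyContinuousPart.
Context d (T : measurableType d) (R : realType)
  (sigma kappa : {finite_measure set T -> \bar R}).

(** Off a [sigma]-null set of largest [kappa]-measure, [kappa] is absolutely
    continuous with respect to [sigma]. *)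
Lemma absolutely_continuous_part : exists A, [/\ measurable A,
  sigma (~` A) = 0%E &
  forall B, measurable B -> sigma B = 0%E -> kappa (B `&` A) = 0%E].
Proof.
pose S := [set fine (kappa N) | N in [set N | measurable N /\ sigma N = 0%E]].
have le_fine N N' : measurable N -> measurable N' -> N `<=` N' ->
    fine (kappa N) <= fine (kappa N').
  by move=> mN mN' NN'; rewrite fine_le ?fin_num_measure// le_measure ?inE.
have supS : has_sup S.
  split; first by exists (fine (kappa set0)), set0.
  by exists (fine (kappa setT)) => _ [N [mN _] <-]; exact: le_fine.
have /choice[N_ N_P] : forall n, exists N, [/\ measurable N, sigma N = 0%E &
    sup S - n.+1%:R^-1 < fine (kappa N)].
  move=> n; have n0 : 0 < (n.+1%:R : R)^-1 by rewrite invr_gt0.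
  by have [_ [N [mN N0] <-] h] := sup_adherent n0 supS; exists N.
pose N := \bigcup_n N_ n.
have mN : measurable N by apply: bigcupT_measurable => n; have [] := N_P n.
have N0 : sigma N = 0%E.
  apply/negligibleP => //; apply: negligible_bigcup => n.
  by have [mNn Nn0 _] := N_P n; exact/negligibleP.
have supN : sup S <= fine (kappa N).
  apply/ler_addgt0Pl => e e0.
  have [n ne] : exists n : nat, n.+1%:R^-1 <= e.
    exists (Num.trunc e^-1); rewrite invf_ple ?posrE//.
    by rewrite ltW// truncnS_gt.
  have [mNn _ h] := N_P n.
  have hN : fine (kappa (N_ n)) <= fine (kappa N).
    by apply: le_fine => //; exact: bigcup_sup.
  apply: le_trans (lerD ne hN); rewrite -lerBlDl; exact: ltW.
exists (~` N); split; [exact: measurableC|by rewrite setCK|].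
move=> B mB B0.
have mBN : measurable (B `&` ~` N) by apply: measurableI => //; exact: measurableC.
have : fine (kappa (N `|` (B `&` ~` N))) <= sup S.
  apply: sup_upper_bound => //; exists (N `|` (B `&` ~` N)) => //; split.
    exact: measurableU.
  apply/negligibleP; first exact: measurableU.
  apply: negligibleU; first exact/negligibleP.
  by apply: (@negligibleS _ _ _ _ B) => [x []//|]; exact/negligibleP.
rewrite measureU//; last by rewrite setIC -setIA setICl setI0.
rewrite fineD ?fin_num_measure// => h.
apply/eqP; rewrite -[X in X == _](@fineK _) ?fin_num_measure// eqe eq_le.
by rewrite fine_ge0// andbT; lra.
Qed.

End AbsolutelyContinuousPart.

Section ComplexLimits.
Context (R : realType).

Lemma ccvg_Re (u : nat -> R[i]) (l : R[i]) : ccvg u l ->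
  complex.Re (u n) @[n --> \oo] --> complex.Re l.
Proof.
move=> /cvgrPdist_lt ul; apply/cvgrPdist_lt => e e0.
have := ul e%:C; rewrite ltcR => /(_ e0); apply: filterS => n.
have -> : complex.Re l - complex.Re (u n) = complex.Re (l - u n).
  by case: (l) => ? ?; case: (u n).
rewrite -ltcR; apply: le_lt_trans; exact: normc_ge_Re.
Qed.

Lemma ccvg_Im (u : nat -> R[i]) (l : R[i]) : ccvg u l ->
  complex.Im (u n) @[n --> \oo] --> complex.Im l.
Proof.
move=> /cvgrPdist_lt ul; apply/cvgrPdist_lt => e e0.
have := ul e%:C; rewrite ltcR => /(_ e0); apply: filterS => n.
have -> : complex.Im l - complex.Im (u n) = complex.Im (l - u n).
  by case: (l) => ? ?; case: (u n).
rewrite -ltcR; apply: le_lt_trans.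
by rewrite normc_def lecR -sqrtr_sqr ler_wsqrtr// lerDr sqr_ge0.
Qed.

End ComplexLimits.

Section WeakStarTransfer.
Context (R : realType) (sigma : {finite_measure set R -> \bar R}).

Lemma Lfun_infty_bounded (f : R -> R) : f \in Lfun sigma +oo%E ->
  exists2 p : R -> R, bounded_measurable p & {ae sigma, forall s, f s = p s}.
Proof.
rewrite inE => /andP[/set_mem/= mf /set_mem/=].
rewrite /finite_norm unlock.
have [s0 fin|s0 _] := ltP 0%E (sigma setT); last first.
  exists (cst 0); first exact: bounded_measurable_cst.
  exists setT; split => //; apply/eqP; rewrite eq_le s0 measure_ge0//.
have [M fM] : exists M : R, {ae sigma, forall s, `|f s| <= M}.
  exists (fine (ess_sup_inf.ess_sup sigma (abse \o (EFin \o f)))).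
  apply: filterS (ess_sup_inf.ess_sup_ge sigma (abse \o (EFin \o f))) => s /= fs.
  rewrite -lee_fin fineK//; rewrite fin_numElt fin andbT.
  by apply: lt_le_trans fs; rewrite ltNyr.
exists (fun s => f s * \1_[set s | `|f s| <= M] s).
  split.
    apply: measurable_funM => //; apply: measurable_indic.
    rewrite -[X in measurable X]setTI; apply: measurable_fun_ler => //.
    exact: measurableT_comp.
  exists `|M| => s; rewrite indicE; case: (boolP (s \in _)) => [/set_mem/= sM|_].
    by rewrite mulr1 (le_trans sM)// ler_norm.
  by rewrite mulr0 normr0.
by apply: filterS fM => s sM; rewrite indicE mem_set ?mulr1.
Qed.

Context (t_ : nat -> R) (phi : R -> R[i]) (p q : R -> R).
Hypothesis hphi : weak_star_limit sigma (fun n s => expi2pi (t_ n * s)) phi.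
Hypothesis bp : bounded_measurable p.
Hypothesis bq : bounded_measurable q.
Hypothesis phip : {ae sigma, forall s, complex.Re (phi s) = p s}.
Hypothesis phiq : {ae sigma, forall s, complex.Im (phi s) = q s}.

Let bm_cos n : bounded_measurable (fun s : R => cos (2 * pi * (t_ n * s))).
Proof. by apply: bounded_measurable_cos; do 2 apply: measurable_funM => //. Qed.

Let bm_sin n : bounded_measurable (fun s : R => sin (2 * pi * (t_ n * s))).
Proof. by apply: bounded_measurable_sin; do 2 apply: measurable_funM => //. Qed.

Let integrable_mul_bounded (r g : R -> R) : sigma.-integrable setT (EFin \o r) ->
  bounded_measurable g -> sigma.-integrable setT (EFin \o (fun s => r s * g s)).
Proof.
move=> ir [mg [M gM]].
have mr : measurable_fun setT r by apply/measurable_EFinP; exact: measurable_int ir.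
apply: (@le_integrable _ _ _ sigma setT measurableT _ (EFin \o (fun s => M * r s))).
- by apply/measurable_EFinP; exact: measurable_funM.
- move=> s _ /=; rewrite lee_fin !normrM mulrC ler_wpM2r//.
  by rewrite (le_trans (gM s))// ler_norm.
- have := integrableZl measurableT M ir; exact: eq_integrable.
Qed.

(** The Radon--Nikodym density of an absolutely continuous measure is an
    integrable test function. *)
Let weak_star_density (kappa : {finite_measure set R -> \bar R}) :
  kappa `<< sigma ->
  (\int[kappa]_s cos (2 * pi * (t_ n * s)) @[n --> \oo] --> \int[kappa]_s p s) /\
  (\int[kappa]_s sin (2 * pi * (t_ n * s)) @[n --> \oo] --> \int[kappa]_s q s).
Proof.
move=> ks; pose r s := fine (Radon_Nikodym (charge_of_finite_measure kappa) sigma s).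
have rE s : (r s)%:E = Radon_Nikodym (charge_of_finite_measure kappa) sigma s.
  by rewrite fineK// Radon_Nikodym_fin_num.
have ir : sigma.-integrable setT (EFin \o r).
  have := @Radon_Nikodym_integrable _ _ _ (charge_of_finite_measure kappa) sigma ks.
  by apply: eq_integrable => // s _; rewrite /= rE.
have kE g : bounded_measurable g -> \int[kappa]_s g s = \int[sigma]_s (r s * g s).
  move=> bg; rewrite /Rintegral; congr fine.
  rewrite -(Radon_Nikodym_change_of_variables ks)//; last first.
    exact: bounded_measurable_integrable.
  by apply: eq_integral => s _; rewrite -rE -EFinM mulrC.
have [Lphi cphi] := hphi.
have Lr : cLfun sigma 1%E (fun s => (r s)%:C).
  by split => /=; rewrite Lfun1_integrable//; exact/Lfun1_integrable/Lfun_cst.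
have aeE (P Q : R -> R) : measurable_fun setT P -> measurable_fun setT Q ->
    {ae sigma, forall s, P s = Q s} ->
    \int[sigma]_s (r s * P s) = \int[sigma]_s (r s * Q s).
  move=> mP mQ PQ; rewrite /Rintegral; congr fine; apply: ae_eq_integral => //.
  - by apply/measurable_EFinP; apply: measurable_funM => //;
      apply/measurable_EFinP; exact: measurable_int ir.
  - by apply/measurable_EFinP; apply: measurable_funM => //;
      apply/measurable_EFinP; exact: measurable_int ir.
  - by apply: filterS PQ => s -> _.
have [LRe LIm] := Lphi.
have mRe : measurable_fun setT (fun s => complex.Re (phi s)).
  by move: LRe; rewrite inE => /andP[/set_mem].
have mIm : measurable_fun setT (fun s => complex.Im (phi s)).
  by move: LIm; rewrite inE => /andP[/set_mem].
have c := cphi _ Lr; split.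
- rewrite kE// -(aeE _ _ mRe bp.1 phip).
  rewrite (_ : \int[sigma]_s (r s * complex.Re (phi s)) =
    complex.Re (cintegral sigma (fun s => (r s)%:C * phi s))); last first.
    by apply: eq_Rintegral => s _; case: (phi s) => x y /=; ring.
  rewrite (_ : (fun n => _) =
    (fun n => complex.Re (cintegral sigma (fun s => (r s)%:C * expi2pi (t_ n * s))))).
    exact: ccvg_Re c.
  by apply/funext => n; rewrite kE//; apply: eq_Rintegral => s _ /=; ring.
- rewrite kE// -(aeE _ _ mIm bq.1 phiq).
  rewrite (_ : \int[sigma]_s (r s * complex.Im (phi s)) =
    complex.Im (cintegral sigma (fun s => (r s)%:C * phi s))); last first.
    by apply: eq_Rintegral => s _; case: (phi s) => x y /=; ring.
  rewrite (_ : (fun n => _) =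
    (fun n => complex.Im (cintegral sigma (fun s => (r s)%:C * expi2pi (t_ n * s))))).
    exact: ccvg_Im c.
  by apply/funext => n; rewrite kE//; apply: eq_Rintegral => s _ /=; ring.
Qed.

(** Convergence against [sigma] passes to any measure on another space, as long as
    [f] maps it to a measure absolutely continuous with respect to [sigma]. *)
Lemma weak_star_transfer d (T : measurableType d) (m : {finite_measure set T -> \bar R})
    (f : T -> R) (D : set T) : measurable_fun setT f -> measurable D ->
  (forall B, measurable B -> sigma B = 0%E -> m (f @^-1` B `&` D) = 0%E) ->
  (\int[m]_(x in D) cos (2 * pi * (t_ n * f x)) @[n --> \oo] -->
     \int[m]_(x in D) p (f x)) /\
  (\int[m]_(x in D) sin (2 * pi * (t_ n * f x)) @[n --> \oo] -->
     \int[m]_(x in D) q (f x)).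
Proof.
move=> mf mD dom.
have ks : image_measure m mf mD `<< sigma by apply/null_content_dominatesP.
have [cc cs] := weak_star_density ks.
split.
- rewrite -(Rintegral_image m mf mD bp).
  rewrite (_ : (fun n => _) = (fun n => 
    \int[image_measure m mf mD]_s cos (2 * pi * (t_ n * s))))//.
  by apply/funext => n; rewrite (Rintegral_image m mf mD (bm_cos n)).
- rewrite -(Rintegral_image m mf mD bq).
  rewrite (_ : (fun n => _) = (fun n => 
    \int[image_measure m mf mD]_s sin (2 * pi * (t_ n * s))))//.
  by apply/funext => n; rewrite (Rintegral_image m mf mD (bm_sin n)).
Qed.

End WeakStarTransfer.

(** * Symmetry of the spectral type and of the multiplier *)

Section Conjugation.
Context d (X : measurableType d) (R : realType).
Implicit Types (f g : X -> R[i]) (mu : {measure set X -> \bar R}).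

(** When the positive and negative parts both have infinite integral, both sides
    are [0]. *)
Lemma RintegralN mu (f : X -> R) : \int[mu]_x (- f x) = - \int[mu]_x f x.
Proof.
rewrite /Rintegral [in LHS]integralE [in RHS]integralE.
rewrite (_ : (fun x => (- f x)%:E) = (fun x => - (f x)%:E)%E)//.
rewrite (_ : ((fun x => - (f x)%:E)^\+ = (fun x => (f x)%:E)^\-)%E); last first.
  exact: funeposN.
rewrite (_ : ((fun x => - (f x)%:E)^\- = (fun x => (f x)%:E)^\+)%E); last first.
  exact: funenegN.
set a := integral _ _ _; set b := integral _ _ _.
have a0 : (0 <= a)%E by apply: integral_ge0.
have b0 : (0 <= b)%E by apply: integral_ge0.
by move: a b a0 b0 => [a| |] [b| |]//= _ _; rewrite ?oppr0// opprB.
Qed.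

Lemma cintegral_conj mu f : cintegral mu (fun x => (f x)^*) = (cintegral mu f)^*.
Proof.
rewrite /cintegral -[RHS]/(_ +i* _) -RintegralN; congr (_ +i* _).
  by apply: eq_Rintegral => x _; case: (f x).
by apply: eq_Rintegral => x _; case: (f x).
Qed.

Lemma inner_conj mu f g :
  inner mu (fun x => (f x)^*) (fun x => (g x)^*) = (inner mu f g)^*.
Proof.
rewrite /inner -cintegral_conj; congr cintegral; apply/funext => x.
by rewrite rmorphM.
Qed.

Lemma L20_conj mu f : L20 mu f -> L20 mu (fun x => (f x)^*).
Proof.
move=> [[fRe fIm] f0]; split.
  split.
    by rewrite (_ : (fun x => _) = (fun x => complex.Re (f x)))//;
      apply/funext => x; case: (f x).
  rewrite (_ : (fun x => _) = - (fun x => complex.Im (f x))).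
    exact: Lfun_oppr_closed.
  by apply/funext => x; rewrite fctE; case: (f x).
by move=> c; rewrite -[c]conjcK (inner_conj mu f (fun=> c^*)) f0 conjc0.
Qed.

End Conjugation.

Section Reflection.
Context d (X : measurableType d) (R : realType) (mu : {measure set X -> \bar R})
  (T : R -> X -> X).

Lemma spectral_measure_cos f nu (t : R) : spectral_measure mu T f nu ->
  \int[nu]_s cos (t * s) =
  complex.Re (inner mu (koopman T (t / (2 * pi)) f) f).
Proof.
move=> ->; rewrite /cintegral/=; apply: eq_Rintegral => s _; congr cos.
by rewrite mulrA [2 * pi * _]mulrC divfK// mulf_neq0// lt0r_neq0// pi_gt0.
Qed.

Lemma spectral_measure_sin f nu (t : R) : spectral_measure mu T f nu ->
  \int[nu]_s sin (t * s) =
  complex.Im (inner mu (koopman T (t / (2 * pi)) f) f).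
Proof.
move=> ->; rewrite /cintegral/=; apply: eq_Rintegral => s _; congr sin.
by rewrite mulrA [2 * pi * _]mulrC divfK// mulf_neq0// lt0r_neq0// pi_gt0.
Qed.

Let moppr : measurable_fun [set: R] (-%R : R -> R).
Proof. exact: oppr_measurable. Qed.

Lemma spectral_measure_reflect f (nu nu' : {finite_measure set R -> \bar R}) :
  spectral_measure mu T f nu ->
  spectral_measure mu T (fun x => (f x)^*) nu' ->
  forall B, measurable B -> nu' B = nu (-%R @^-1` B).
Proof.
move=> fnu fnu' B mB.
have kE t : inner mu (koopman T t (fun x => (f x)^*)) (fun x => (f x)^*) =
    (inner mu (koopman T t f) f)^* by rewrite -inner_conj.
have -> : nu (-%R @^-1` B) = image_measure nu moppr measurableT B.
  by rewrite /image_measure setIT.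
have mts t : measurable_fun setT (fun s : R => t * s) by exact: measurable_funM.
apply: fourier_uniqueness => // t.
- rewrite (Rintegral_image nu moppr measurableT (bounded_measurable_cos (mts t))).
  rewrite (spectral_measure_cos t fnu') kE.
  rewrite (@eq_Rintegral _ _ _ nu _ (fun s => cos (t * s))); last first.
    by move=> s _; rewrite mulrN cosN.
  by rewrite (spectral_measure_cos t fnu); case: (inner _ _ _).
- rewrite (Rintegral_image nu moppr measurableT (bounded_measurable_sin (mts t))).
  rewrite (spectral_measure_sin t fnu') kE.
  rewrite (@eq_Rintegral _ _ _ nu _ (fun s => - sin (t * s))); last first.
    by move=> s _; rewrite mulrN sinN.
  by rewrite RintegralN (spectral_measure_sin t fnu); case: (inner _ _ _).
Qed.

(** The Koopman operators commute with complex conjugation, which reflects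
    spectral measures; so the maximal spectral type of a flow is symmetric. *)
Lemma spectral_type_symmetric (sigma : {finite_measure set R -> \bar R}) :
  reduced_maximal_spectral_type mu T sigma ->
  forall B, measurable B -> sigma B = 0%E -> sigma (-%R @^-1` B) = 0%E.
Proof.
move=> [dom [f Lf [nu [fnu nus sn]]]] B mB B0.
have [nu' [fnu' nu's]] := dom _ (L20_conj Lf).
have mB' : measurable (-%R @^-1` B : set R).
  by rewrite -[X in measurable X]setTI; exact: moppr.
have nu0 : nu (-%R @^-1` B) = 0%E.
  rewrite -(spectral_measure_reflect fnu fnu')//.
  by move/null_content_dominatesP : nu's; apply.
by move/null_content_dominatesP : sn; apply.
Qed.

End Reflection.

Section MultiplierSymmetry.
Context (R : realType) (sigma : {finite_measure set R -> \bar R}).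
Hypothesis sigmaN : forall B, measurable B -> sigma B = 0%E ->
  sigma (-%R @^-1` B) = 0%E.
Context (t_ : nat -> R) (phi : R -> R[i]) (p q : R -> R).
Hypothesis hphi : weak_star_limit sigma (fun n s => expi2pi (t_ n * s)) phi.
Hypothesis bp : bounded_measurable p.
Hypothesis bq : bounded_measurable q.
Hypothesis phip : {ae sigma, forall s, complex.Re (phi s) = p s}.
Hypothesis phiq : {ae sigma, forall s, complex.Im (phi s) = q s}.

Lemma ae_eq_bounded d (T : measurableType d) (m : {finite_measure set T -> \bar R})
    (f g : T -> R) :
  bounded_measurable f -> bounded_measurable g ->
  (forall B, measurable B -> \int[m]_(s in B) f s = \int[m]_(s in B) g s) ->
  {ae m, forall s, f s = g s}.
Proof.
move=> bf bg fg.
have : ae_eq m setT (EFin \o f) (EFin \o g).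
  apply: integral_ae_eq => //.
  - exact: bounded_measurable_integrable.
  - by apply/measurable_EFinP; case: bg.
  - move=> B _ mB.
    have ifB := bounded_measurable_integrable m mB bf.
    have igB := bounded_measurable_integrable m mB bg.
    rewrite -[LHS]fineK; last exact: integrable_fin_num.
    rewrite -[RHS]fineK; last exact: integrable_fin_num.
    by congr (_%:E); exact: fg.
by apply: filterS => s /(_ I) /= [].
Qed.

(** The characters are hermitian, and by the symmetry of [sigma] so is their weak
    limit: test it against [sigma] and against its reflection. *)
Lemma multiplier_symmetric :
  {ae sigma, forall s, p (- s) = p s} /\ {ae sigma, forall s, q (- s) = - q s}.
Proof.
have mN : measurable_fun [set: R] (-%R : R -> R) by exact: oppr_measurable.
have bN (g : R -> R) : bounded_measurable g ->
    bounded_measurable (fun s : R => g (- s)).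
  move=> [mg [M gM]]; split; first exact: (measurableT_comp mg mN).
  by exists M => s; exact: gM.
have mpre (B : set R) : measurable B -> measurable (-%R @^-1` B : set R).
  by move=> mB; rewrite -[X in measurable X]setTI; exact: mN.
have transfer :=
  @weak_star_transfer _ _ _ _ _ _ hphi bp bq phip phiq _ _ sigma.
have tid (B : set R) : measurable B ->
    (\int[sigma]_(x in B) cos (2 * pi * (t_ n * x)) @[n --> \oo] -->
      \int[sigma]_(x in B) p x) /\
    (\int[sigma]_(x in B) sin (2 * pi * (t_ n * x)) @[n --> \oo] -->
      \int[sigma]_(x in B) q x).
  move=> mB; apply: (transfer id B) => // C mC C0.
  by apply/eqP; rewrite -measure_le0 -C0 le_measure ?inE//=; exact: measurableI.
have tN (B : set R) : measurable B ->
    (\int[sigma]_(x in B) cos (2 * pi * (t_ n * - x)) @[n --> \oo] -->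
      \int[sigma]_(x in B) p (- x)) /\
    (\int[sigma]_(x in B) sin (2 * pi * (t_ n * - x)) @[n --> \oo] -->
      \int[sigma]_(x in B) q (- x)).
  move=> mB; apply: (transfer -%R B) => // C mC C0.
  have mC' := mpre C mC.
  by apply/eqP; rewrite -measure_le0 -(sigmaN mC C0) le_measure ?inE//=;
    exact: measurableI.
split; apply: ae_eq_bounded => //; do ?[exact: bN|exact: bounded_measurableN] => B mB.
- have [c _] := tid B mB; have [c' _] := tN B mB.
  apply: (cvg_unique _ c') => //.
  rewrite (_ : (fun n => _) = (fun n => \int[sigma]_(x in B) cos (2 * pi * (t_ n * x))))//.
  by apply/funext => n; apply: eq_Rintegral => s _; rewrite !mulrN cosN.
- have [_ c] := tid B mB; have [_ c'] := tN B mB.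
  have NE (g : R -> R) : bounded_measurable g ->
      \int[sigma]_(x in B) (- g x) = - \int[sigma]_(x in B) g x.
    move=> bg; rewrite -[RHS]mulN1r -RintegralZl//; last exact: bounded_measurable_integrable.
    by apply: eq_Rintegral => s _; rewrite mulN1r.
  rewrite NE//; apply: (cvg_unique _ c') => //.
  rewrite (_ : (fun n => _) = (fun n => - \int[sigma]_(x in B) sin (2 * pi * (t_ n * x)))).
    exact: cvgN.
  apply/funext => n; rewrite -NE.
    by apply: eq_Rintegral => s _; rewrite !mulrN sinN.
  by apply: bounded_measurable_sin; do 2 apply: measurable_funM => //.
Qed.

End MultiplierSymmetry.

(** * Rigidity of analytic functions that factor on sums *)

Section ComplexAnalytic.
Context (R : realType).
Implicit Types (f g h : R -> R[i]).

Definition canalytic f := ranalytic (fun x => complex.Re (f x)) /\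
  ranalytic (fun x => complex.Im (f x)).

Lemma real_analytic_canalytic f : real_analytic f -> canalytic f.
Proof.
have termE (t : R) k (a : R[i]) :
    a * t%:C ^+ k = (complex.Re a * t ^+ k) +i* (complex.Im a * t ^+ k).
  by rewrite -rmorphXn; case: a => a b /=; congr (_ +i* _); ring.
have ReD (x y : R[i]) : complex.Re (x + y) = complex.Re x + complex.Re y.
  by case: x; case: y.
have ImD (x y : R[i]) : complex.Im (x + y) = complex.Im x + complex.Im y.
  by case: x; case: y.
move=> af; split=> x0; have [r r0 [a fa]] := af x0; exists r => //.
- exists (fun k => complex.Re (a k)) => x /fa/ccvg_Re.
  rewrite (_ : (fun n => complex.Re _) =
    (fun n => \sum_(k < n) complex.Re (a k) * (x - x0) ^+ k))//.
  apply/funext => n; rewrite (big_morph _ ReD (erefl : complex.Re (0 : R[i]) = 0)).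
  by apply: eq_bigr => k _; rewrite termE.
- exists (fun k => complex.Im (a k)) => x /fa/ccvg_Im.
  rewrite (_ : (fun n => complex.Im _) =
    (fun n => \sum_(k < n) complex.Im (a k) * (x - x0) ^+ k))//.
  apply/funext => n; rewrite (big_morph _ ImD (erefl : complex.Im (0 : R[i]) = 0)).
  by apply: eq_bigr => k _; rewrite termE.
Qed.

Lemma canalytic_shift f c : canalytic f -> canalytic (fun x => f (c + x)).
Proof.
move=> [fr fi].
by split; [exact: (ranalytic_shift c fr)|exact: (ranalytic_shift c fi)].
Qed.

Lemma canalytic_conjN f : canalytic f -> canalytic (fun x => (f (- x))^*).
Proof.
move=> [fr fi]; split.
  rewrite (_ : (fun x => _) = (fun x => complex.Re (f (- x)))).
    exact: (ranalyticN fr).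
  by apply/funext => x; case: (f _).
rewrite (_ : (fun x => _) = (fun x => -1 * complex.Im (f (- x)) + 0 * complex.Im (f (- x)))).
  exact: (ranalytic_lin (-1) 0 (ranalyticN fi) (ranalyticN fi)).
by apply/funext => x; case: (f _) => a b /=; ring.
Qed.

Lemma canalytic_lin f g (c e : R[i]) : canalytic f -> canalytic g ->
  canalytic (fun x => c * f x - e * g x).
Proof.
case: c e => [c1 c2] [e1 e2] [fr fi] [gr gi]; split.
- rewrite (_ : (fun x => _) = (fun x =>
    1 * (c1 * complex.Re (f x) + (- c2) * complex.Im (f x)) +
    (-1) * (e1 * complex.Re (g x) + (- e2) * complex.Im (g x)))).
    by apply: ranalytic_lin; exact: ranalytic_lin.
  by apply/funext => x; case: (f x) => a b; case: (g x) => a' b' /=; ring.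
- rewrite (_ : (fun x => _) = (fun x =>
    1 * (c1 * complex.Im (f x) + c2 * complex.Re (f x)) +
    (-1) * (e1 * complex.Im (g x) + e2 * complex.Re (g x)))).
    by apply: ranalytic_lin; exact: ranalytic_lin.
  by apply/funext => x; case: (f x) => a b; case: (g x) => a' b' /=; ring.
Qed.

Lemma complex_ReIm0 (z : R[i]) : complex.Re z = 0 -> complex.Im z = 0 -> z = 0.
Proof. by case: z => a b /= -> ->. Qed.

Lemma canalytic_identity f z : canalytic f ->
  (forall e, 0 < e -> exists t, 0 < `|t| < e /\ f (z + t) = 0) ->
  forall x, f x = 0.
Proof.
move=> [fr fi] facc x; apply: complex_ReIm0.
- apply: (@analytic_identity _ _ z fr) => e e0.
  by have [t [te ft]] := facc e e0; exists t; rewrite ft.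
- apply: (@analytic_identity _ _ z fi) => e e0.
  by have [t [te ft]] := facc e e0; exists t; rewrite ft.
Qed.

Lemma canalytic_identity_measure f B (lam : {finite_measure set R -> \bar R}) :
  continuous_measure lam -> canalytic f -> measurable B ->
  lam B != 0%E -> (forall x, B x -> f x = 0) -> forall x, f x = 0.
Proof.
move=> clam [fr fi] mB B0 fB x; apply: complex_ReIm0.
- by apply: (analytic_identity_measure clam fr mB B0) => y /fB ->.
- by apply: (analytic_identity_measure clam fi mB B0) => y /fB ->.
Qed.

(** If an analytic function of [x + y] is a product of a function of [x] and a
    function of [y] on a set of positive product mass, then two points [x], [x']
    whose sections overlap in positive mass make [h (. + x' - x)] proportional to [h]. Such
    [x' - x] exist arbitrarily close to [0], and proportionality, being an
    analytic condition on the translation, holds for all translations. *)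
Lemma sum_factorization_rigid (lam1 lam2 : {finite_measure set R -> \bar R})
    (h phi1 phi2 : R -> R[i]) (E : set (R * R)) :
  continuous_measure lam1 -> continuous_measure lam2 -> canalytic h ->
  measurable E -> finite_product lam1 lam2 E != 0%E ->
  (forall z, E z -> phi1 z.1 * phi2 z.2 = h (z.1 + z.2)) ->
  forall y y0 p, h (y0) * h (y + p) = h y * h (y0 + p).
Proof.
move=> c1 c2 ah mE E0 Eh.
have [h0|/existsNP[w hw]] := pselect (forall s, h s = 0).
  by move=> y y0 p; rewrite !h0 !mul0r.
pose F x := xsection E x; have mF x : measurable (F x) by exact: measurable_xsection.
have mlF : measurable_fun setT (lam2 \o F) by exact: measurable_fun_xsection.
pose G := [set x | lam2 (F x) != 0%E].
have mG : measurable G.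
  by rewrite -[X in measurable X]setTI; exact: emeasurable_neq.
have G0 : lam1 G != 0%E.
  apply: contra_neq E0 => G0; rewrite /finite_product /product_measure1.
  rewrite (@ge0_negligible_integral _ _ _ lam1 setT G)//.
  by apply: integral0_eq => x [_ /negP]; rewrite negbK => /eqP.
have FE x y : F x y -> E (x, y) by rewrite /F /xsection/= => /set_mem.
have phi0 x : G x -> phi1 x != 0.
  move=> Gx; apply/eqP => px0; apply: hw.
  have H : forall y, h (x + y) = 0.
    apply: (canalytic_identity_measure c2 (canalytic_shift x ah) (mF x) Gx).
    by move=> y /FE/Eh/= <-; rewrite px0 mul0r.
  by rewrite -(H (w - x)); congr h; ring.
move=> y y0; set D := fun p => h y0 * h (y + p) - h y * h (y0 + p).
have aD : canalytic D by apply: canalytic_lin; exact: canalytic_shift.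
suff D0 : forall p, D p = 0 by move=> p; apply/eqP; rewrite -subr_eq0; apply/eqP/D0.
apply: (@canalytic_identity _ 0 aD) => e e0.
have [x [x' [Gx Gx' xe ov]]] := close_overlapping_pair c1 mG G0 mF mlF (fun x => id) e0.
exists (x' - x); split => //; rewrite add0r.
have prop : forall s, phi1 x' * h (x + s) - phi1 x * h (x' + s) = 0.
  apply: (canalytic_identity_measure c2 _ (measurableI _ _ (mF x) (mF x')) ov).
    by apply: canalytic_lin; exact: canalytic_shift.
  by move=> s [/FE/Eh/= <- /FE/Eh/= <-]; ring.
have prop' s : phi1 x * h (s + (x' - x)) = phi1 x' * h s.
  apply/eqP; rewrite eq_sym -subr_eq0 -(prop (s - x)); apply/eqP.
  by congr (_ * h _ - _ * h _); ring.
apply: (mulfI (phi0 _ Gx)); rewrite /D mulr0 mulrBr.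
by rewrite [_ * (h y0 * _)]mulrCA prop' [_ * (h y * _)]mulrCA prop'; ring.
Qed.

End ComplexAnalytic.

Section Exponential.
Context (R : realType).

Lemma is_derive_translate (f : R -> R) (c x df : R) :
  is_derive (x + c) 1 f df -> is_derive x 1 (fun y => f (y + c)) df.
Proof.
move=> fd; rewrite -[df]mulr1.
exact: (@is_derive1_comp _ f (shift c) x df 1 fd (is_derive_shift x 1 c)).
Qed.

(** Up to the factor [h 0], which is real, [h] is multiplicative; together with
    the symmetry this yields [u' = - b v] and [v' = b u] for its real and
    imaginary parts, so that [h] rotates uniformly. *)
Lemma hermitian_exponential (h : R -> R[i]) : canalytic h ->
  (forall s, h (- s) = (h s)^*) ->
  (forall y y0 p, h y0 * h (y + p) = h y * h (y0 + p)) ->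
  exists c s0, forall s, h s = c * expi2pi (s0 * s).
Proof.
move=> [au av] hN hmul.
have [h0|hn0] := eqVneq (h 0) 0.
  exists 0, 0 => s; rewrite mul0r; apply/eqP.
  have := hmul (s + s) s (- s); rewrite addrK subrr h0 mulr0.
  by move/eqP; rewrite mulf_eq0 orbb.
pose u s := complex.Re (h s); pose v s := complex.Im (h s).
have v0 : v 0 = 0.
  by have := hN 0; rewrite oppr0 /v; case: (h 0) => a b [] /=; lra.
have hE s : h s = u s +i* v s by rewrite /u /v; case: (h s).
have u0 : u 0 != 0 by apply: contra_neq hn0 => u0; rewrite hE u0 v0.
have uN s : u (- s) = u s by rewrite /u hN; case: (h s).
have vN s : v (- s) = - v s by rewrite /v hN; case: (h s).
have umul y p : u 0 * u (p + y) = u y * u p - v y * v p.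
  have := hmul y 0 p; rewrite add0r addrC !hE v0 => -[] /=; lra.
have vmul y p : u 0 * v (p + y) = u y * v p + v y * u p.
  have := hmul y 0 p; rewrite add0r addrC !hE v0 => -[] /=; lra.
have du (x : R) : is_derive x 1 u ('D_1 u x) by apply/derivableP/ranalytic_derivable.
have dv (x : R) : is_derive x 1 v ('D_1 v x) by apply/derivableP/ranalytic_derivable.
set b := 'D_1 v 0 / u 0.
have u'0 : 'D_1 u 0 = 0.
  have D : is_derive (0 : R) 1 (u * u + v * v) 0.
    rewrite (_ : u * u + v * v = cst (u 0 * u 0)); first exact: is_derive_cst.
    apply/funext => y; have := umul y (- y).
    by rewrite addNr uN vN mulrN opprK.
  have D' := is_deriveD (is_deriveM (du 0) (du 0)) (is_deriveM (dv 0) (dv 0)).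
  have := @derive_val _ _ _ _ _ _ _ D.
  rewrite (@derive_val _ _ _ _ _ _ _ D') v0 !scale0r !addr0.
  by rewrite -mulr2n => /eqP; rewrite mulrn_eq0/= scaler_eq0 (negPf u0) => /eqP.
have du' (y : R) : is_derive y 1 u (- b * v y).
  suff <- : 'D_1 u y = - b * v y by exact: du.
  have D : is_derive (0 : R) 1 (u 0 \*: (fun p => u (p + y))) (u 0 *: 'D_1 u y).
    by apply: is_deriveZ; apply: is_derive_translate; rewrite add0r.
  have D' := is_deriveB (is_deriveZ (u y) (du 0)) (is_deriveZ (v y) (dv 0)).
  have := @derive_val _ _ _ _ _ _ _ D.
  rewrite (_ : _ \*: _ = u y \*: u - v y \*: v); last first.
    by apply/funext => p; exact: umul.
  rewrite (@derive_val _ _ _ _ _ _ _ D') u'0 scaler0 sub0r => h1.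
  by apply: (mulfI u0); rewrite -[LHS]h1 /b /GRing.scale/=; field.
have dv' (y : R) : is_derive y 1 v (b * u y).
  suff <- : 'D_1 v y = b * u y by exact: dv.
  have D : is_derive (0 : R) 1 (u 0 \*: (fun p => v (p + y))) (u 0 *: 'D_1 v y).
    by apply: is_deriveZ; apply: is_derive_translate; rewrite add0r.
  have D' := is_deriveD (is_deriveZ (u y) (dv 0)) (is_deriveZ (v y) (du 0)).
  have := @derive_val _ _ _ _ _ _ _ D.
  rewrite (_ : _ \*: _ = u y \*: v + v y \*: u); last first.
    by apply/funext => p; exact: vmul.
  rewrite (@derive_val _ _ _ _ _ _ _ D') u'0 scaler0 addr0 => h1.
  by apply: (mulfI u0); rewrite -[LHS]h1 /b /GRing.scale/=; field.
have dcos (y : R) : is_derive y 1 (fun s => cos (b * s)) (- sin (b * y) * b).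
  apply: (@is_derive1_comp _ cos ( *%R b)).
  by have := is_deriveZ b (is_derive_id y 1); rewrite /GRing.scale/= mulr1.
have dsin (y : R) : is_derive y 1 (fun s => sin (b * s)) (cos (b * y) * b).
  apply: (@is_derive1_comp _ sin ( *%R b)).
  by have := is_deriveZ b (is_derive_id y 1); rewrite /GRing.scale/= mulr1.
have w1 s : u s * cos (b * s) + v s * sin (b * s) = u 0.
  have D (y : R) : is_derive y 1 (u * (fun s => cos (b * s)) + v * (fun s => sin (b * s))) 0.
    have := is_deriveD (is_deriveM (du' y) (dcos y)) (is_deriveM (dv' y) (dsin y)).
    rewrite (_ : _ + (_ + _) = 0)// /GRing.scale/=; ring.
  transitivity (u 0 * cos (b * 0) + v 0 * sin (b * 0)).
    exact: (is_derive_0_is_cst s 0 D).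
  by rewrite mulr0 cos0 sin0 mulr1 mulr0 addr0.
have w2 s : u s * sin (b * s) - v s * cos (b * s) = 0.
  have D (y : R) : is_derive y 1 (u * (fun s => sin (b * s)) - v * (fun s => cos (b * s))) 0.
    have := is_deriveB (is_deriveM (du' y) (dsin y)) (is_deriveM (dv' y) (dcos y)).
    rewrite (_ : _ - (_ + _) = 0)// /GRing.scale/=; ring.
  transitivity (u 0 * sin (b * 0) - v 0 * cos (b * 0)).
    exact: (is_derive_0_is_cst s 0 D).
  by rewrite mulr0 cos0 sin0 v0 mulr0 mul0r subr0.
exists (u 0)%:C, (b / (2 * pi)) => s.
rewrite hE /expi2pi.
have -> : 2 * pi * (b / (2 * pi) * s) = b * s.
  by rewrite mulrA [2 * pi * _]mulrC divfK// mulf_neq0// lt0r_neq0// pi_gt0.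
have cs := cos2Dsin2 (b * s); have := w1 s; have := w2 s.
set C := cos _ in cs *; set S := sin _ in cs * => e2 e1.
have -> : u s = u 0 * C.
  rewrite -e1 -[LHS]mulr1 -cs.
  by rewrite -[RHS]addr0 -[X in _ = _ + X](mul0r S) -e2; ring.
have -> : v s = u 0 * S.
  rewrite -e1 -[LHS]mulr1 -cs.
  by rewrite -[RHS]subr0 -[X in _ = _ - X](mul0r C) -e2; ring.
by congr (_ +i* _); ring.
Qed.

End Exponential.

(** * Polarization on the complex L^2 *)

Section ComplexL2.
Context d (X : measurableType d) (R : realType) (mu : {measure set X -> \bar R}).
Implicit Types f g h F G : X -> R[i].

Definition cintegrable F := mu.-integrable setT (fun x => (complex.Re (F x))%:E) /\
  mu.-integrable setT (fun x => (complex.Im (F x))%:E).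

Let integrable_lin2 (a b : R) (u v : X -> R) :
  mu.-integrable setT (EFin \o u) -> mu.-integrable setT (EFin \o v) ->
  mu.-integrable setT (EFin \o (fun x => a * u x + b * v x)).
Proof.
move=> iu iv.
have := integrableD measurableT (integrableZl measurableT a iu)
  (integrableZl measurableT b iv).
exact: eq_integrable.
Qed.

Let Rintegral_lin2 (a b : R) (u v : X -> R) :
  mu.-integrable setT (EFin \o u) -> mu.-integrable setT (EFin \o v) ->
  \int[mu]_x (a * u x + b * v x) = a * (\int[mu]_x u x) + b * (\int[mu]_x v x).
Proof.
move=> iu iv.
have zi (c : R) w : mu.-integrable setT (EFin \o w) ->
    mu.-integrable setT (EFin \o (fun x => c * w x)).
  by move=> iw; have := integrableZl measurableT c iw; exact: eq_integrable.
rewrite (RintegralD measurableT (zi a u iu) (zi b v iv)).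
by rewrite (RintegralZl a measurableT iu) (RintegralZl b measurableT iv).
Qed.

Lemma cintegral_lin (a : R[i]) F G : cintegrable F -> cintegrable G ->
  cintegral mu (fun x => a * F x + G x) = a * cintegral mu F + cintegral mu G.
Proof.
case: a => a b [Fr Fi] [Gr Gi].
apply/eqP; rewrite eq_complex; apply/andP; split; apply/eqP.
- transitivity (\int[mu]_x (1 * (a * complex.Re (F x) + - b * complex.Im (F x))
      + 1 * complex.Re (G x))); last first.
    by rewrite (Rintegral_lin2 1 1 (integrable_lin2 a (- b) Fr Fi) Gr)
      (Rintegral_lin2 a (- b) Fr Fi) /=; ring.
  by apply: eq_Rintegral => x _; case: (F x) => ? ?; case: (G x) => ? ? /=; ring.
- transitivity (\int[mu]_x (1 * (a * complex.Im (F x) + b * complex.Re (F x))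
      + 1 * complex.Im (G x))); last first.
    by rewrite (Rintegral_lin2 1 1 (integrable_lin2 a b Fi Fr) Gi)
      (Rintegral_lin2 a b Fi Fr) /=; ring.
  by apply: eq_Rintegral => x _; case: (F x) => ? ?; case: (G x) => ? ? /=; ring.
Qed.

Lemma cintegrable_inner f g : cLfun mu 2%:E f -> cLfun mu 2%:E g ->
  cintegrable (fun x => f x * (g x)^*).
Proof.
move=> [fr fi] [gr gi].
have P u v : u \in Lfun mu 2%:E -> v \in Lfun mu 2%:E ->
    mu.-integrable setT (EFin \o (fun x => u x * v x)).
  by move=> lu lv; apply/Lfun1_integrable; exact: Lfun2_mul_Lfun1.
split.
- have := integrable_lin2 1 1 (P _ _ fr gr) (P _ _ fi gi).
  apply: eq_integrable => // x _ /=; congr (_%:E).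
  by case: (f x) => ? ?; case: (g x) => ? ? /=; ring.
- have := integrable_lin2 1 (-1) (P _ _ fi gr) (P _ _ fr gi).
  apply: eq_integrable => // x _ /=; congr (_%:E).
  by case: (f x) => ? ?; case: (g x) => ? ? /=; ring.
Qed.

Lemma inner_linl (a : R[i]) f g h : cLfun mu 2%:E f -> cLfun mu 2%:E g ->
  cLfun mu 2%:E h ->
  inner mu (fun x => a * f x + g x) h = a * inner mu f h + inner mu g h.
Proof.
move=> lf lg lh; rewrite /inner -cintegral_lin; do ?exact: cintegrable_inner.
by congr cintegral; apply/funext => x; ring.
Qed.

Lemma inner_linr (a : R[i]) f g h : cLfun mu 2%:E f -> cLfun mu 2%:E g ->
  cLfun mu 2%:E h ->
  inner mu h (fun x => a * f x + g x) = a^* * inner mu h f + inner mu h g.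
Proof.
move=> lf lg lh; rewrite /inner -cintegral_lin; do ?exact: cintegrable_inner.
by congr cintegral; apply/funext => x; rewrite rmorphD rmorphM/=; ring.
Qed.

Lemma cLfun_lin (a : R[i]) f g : cLfun mu 2%:E f -> cLfun mu 2%:E g ->
  cLfun mu 2%:E (fun x => a * f x + g x).
Proof.
have p1 : (1 <= 2%:E :> \bar R)%E by rewrite lee1n.
have [_ cl] := Lfun_submod_closed mu p1.
case: a => a b [fr fi] [gr gi]; split.
- have := cl a _ _ fr (cl (- b) _ _ fi gr).
  rewrite (_ : _ + _ = (fun x => complex.Re ((a +i* b) * f x + g x)))//.
  apply/funext => x.
  rewrite -[LHS]/(a * complex.Re (f x) + (- b * complex.Im (f x) + complex.Re (g x))).
  by case: (f x) => ? ?; case: (g x) => ? ? /=; ring.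
- have := cl a _ _ fi (cl b _ _ fr gi).
  rewrite (_ : _ + _ = (fun x => complex.Im ((a +i* b) * f x + g x)))//.
  apply/funext => x.
  rewrite -[LHS]/(a * complex.Im (f x) + (b * complex.Re (f x) + complex.Im (g x))).
  by case: (f x) => ? ?; case: (g x) => ? ? /=; ring.
Qed.

Lemma cLfun_measurable (p : \bar R) f : cLfun mu p f ->
  measurable_fun setT (fun x => complex.Re (f x)) /\
  measurable_fun setT (fun x => complex.Im (f x)).
Proof.
by move=> []; rewrite !inE => /andP[/set_mem ? _] /andP[/set_mem].
Qed.

Lemma inner_ae f g h : cLfun mu 2%:E f -> cLfun mu 2%:E g -> cLfun mu 2%:E h ->
  {ae mu, forall x, f x = g x} -> inner mu f h = inner mu g h.
Proof.
move=> lf lg lh fg.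
have [ir ii] := cintegrable_inner lf lh; have [jr ji] := cintegrable_inner lg lh.
apply/eqP; rewrite eq_complex; apply/andP; split; apply/eqP; rewrite /=/Rintegral;
  congr fine; apply: ae_eq_integral => //.
- exact: measurable_int ir.
- exact: measurable_int jr.
- by apply: filterS fg => x /= -> _.
- exact: measurable_int ii.
- exact: measurable_int ji.
- by apply: filterS fg => x /= -> _.
Qed.

Lemma inner_eq0 f : cLfun mu 2%:E f -> inner mu f f = 0 ->
  {ae mu, forall x, f x = 0}.
Proof.
move=> lf; have [ir _] := cintegrable_inner lf lf; move=> ff0.
pose n x := complex.Re (f x) ^+ 2 + complex.Im (f x) ^+ 2.
have nE x : complex.Re (f x * (f x)^*) = n x.
  by rewrite /n; case: (f x) => ? ? /=; ring.
have n0 x : 0 <= n x by rewrite addr_ge0// sqr_ge0.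
have iN : mu.-integrable setT (EFin \o n).
  by move: ir; apply: eq_integrable => // x _ /=; rewrite nE.
have In0 : (\int[mu]_x `|(EFin \o n) x| = 0)%E.
  have E : \int[mu]_x n x = 0.
    transitivity (complex.Re (inner mu f f)); last by rewrite ff0.
    by apply: eq_Rintegral => x _; rewrite nE.
  under eq_integral do rewrite /= ger0_norm//.
  rewrite -[LHS]fineK; first exact: (congr1 EFin E).
  exact: (integrable_fin_num _ iN).
have := (ae_eq_integral_abs mu measurableT (measurable_int _ iN)).1 In0.
apply: filterS => x /(_ I)[] /eqP; rewrite paddr_eq0 ?sqr_ge0// !sqrf_eq0.
by case: (f x) => a b /= /andP[/eqP -> /eqP ->].
Qed.

End ComplexL2.

Section Koopman.
Context d (X : measurableType d) (R : realType) (mu : probability X R)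
  (T : R -> X -> X).
Hypothesis hT : measurable_mp_flow mu T.
Implicit Types f g : X -> R[i].

Lemma measurable_flow t : measurable_fun [set: X] (T t).
Proof.
case: hT => mT _ _ _.
exact: (measurableT_comp mT (pair1_measurable t)).
Qed.

Lemma ge0_integral_flow t (g : X -> \bar R) : measurable_fun setT g ->
  (forall x, 0 <= g x)%E -> (\int[mu]_x g (T t x) = \int[mu]_x g x)%E.
Proof.
move=> mg g0; have mTt := measurable_flow t.
rewrite -(@ge0_integral_pushforward _ _ _ _ _ (T t) mTt mu setT g)//.
by apply: eq_measure_integral => A mA _; case: hT => _ _ _; exact.
Qed.

Lemma Rintegral_flow t (g : X -> R) : measurable_fun setT g ->
  \int[mu]_x g (T t x) = \int[mu]_x g x.
Proof.
move=> /measurable_EFinP mg; rewrite /Rintegral; congr fine.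
rewrite [LHS]integralE [RHS]integralE; congr (_ - _)%E.
- rewrite -(ge0_integral_flow t (measurable_funepos mg)) => [|x]; last exact: funepos_ge0.
  by apply: eq_integral => x _; rewrite -[RHS]/(((EFin \o g)^\+ \o T t) x)%E -funepos_comp.
- rewrite -(ge0_integral_flow t (measurable_funeneg mg)) => [|x]; last exact: funeneg_ge0.
  by apply: eq_integral => x _; rewrite -[RHS]/(((EFin \o g)^\- \o T t) x)%E -funeneg_comp.
Qed.

Lemma Lfun_flow t (g : X -> R) : g \in Lfun mu 2%:E ->
  (fun x => g (T t x)) \in Lfun mu 2%:E.
Proof.
rewrite !inE => /andP[/set_mem/= mg /set_mem/= fg].
apply/andP; split; apply/mem_set => /=.
  exact: measurableT_comp (measurable_flow t).
move: fg; rewrite /finite_norm unlock.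
rewrite -(ge0_integral_flow t) => [//||x]; last exact: poweR_ge0.
  apply: (measurableT_comp (measurable_poweR 2)).
  by apply: measurableT_comp => //; exact/measurable_EFinP.
Qed.

Lemma L20_koopman t f : L20 mu f -> L20 mu (koopman T t f).
Proof.
move=> [[fr fi] f0]; split; first by split; [exact: Lfun_flow fr|exact: Lfun_flow fi].
move=> c; rewrite -(f0 c) /inner /cintegral /koopman/=.
have mr : measurable_fun setT (fun x => complex.Re (f x)).
  by move: fr; rewrite inE => /andP[/set_mem].
have mi : measurable_fun setT (fun x => complex.Im (f x)).
  by move: fi; rewrite inE => /andP[/set_mem].
have mfr (a b : R) : measurable_fun setT
    (fun x => a * complex.Re (f x) + b * complex.Im (f x)).
  by apply: measurable_funD; exact: measurable_funM.
case: c => a b; congr (_ +i* _).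
- apply: (Rintegral_flow t (g := fun x => complex.Re (f x * (a +i* b)^*))).
  rewrite (_ : (fun x => _) = (fun x => a * complex.Re (f x) + b * complex.Im (f x)))//.
  by apply/funext => x; case: (f x) => ? ? /=; ring.
- apply: (Rintegral_flow t (g := fun x => complex.Im (f x * (a +i* b)^*))).
  rewrite (_ : (fun x => _) = (fun x => - b * complex.Re (f x) + a * complex.Im (f x)))//.
  by apply/funext => x; case: (f x) => ? ? /=; ring.
Qed.

Lemma L20_lin (a : R[i]) f g : L20 mu f -> L20 mu g ->
  L20 mu (fun x => a * f x + g x).
Proof.
move=> [lf f0] [lg g0]; split; first exact: cLfun_lin.
move=> c; rewrite inner_linl// ?f0 ?g0 ?mulr0 ?addr0//.
by split; exact: Lfun_cst.
Qed.

(** The quadratic form of [V - c T_s] vanishes, and over the complex numbers a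
    quadratic form determines its operator by polarization. *)
Lemma scaled_koopman_of_quadratic V (c : R[i]) (s : R) : L20_operator mu V ->
  (forall f, L20 mu f -> inner mu (V f) f = c * inner mu (koopman T s f) f) ->
  is_scaled_koopman mu T V c s.
Proof.
move=> hV hq.
pose W f x := - c * koopman T s f x + V f x.
have LW f : L20 mu f -> L20 mu (W f).
  by move=> Lf; apply: L20_lin; [exact: L20_koopman|exact: L20_operator_stable hV _ Lf].
have WE f g : L20 mu f -> L20 mu g ->
    inner mu (W f) g = - c * inner mu (koopman T s f) g + inner mu (V f) g.
  move=> Lf Lg; apply: inner_linl.
  - exact: (L20_koopman s Lf).1.
  - exact: (L20_operator_stable hV Lf).1.
  - exact: Lg.1.
have Wff f : L20 mu f -> inner mu (W f) f = 0.
  by move=> Lf; rewrite WE// hq//; ring.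
have Wlin a f g h : L20 mu f -> L20 mu g -> L20 mu h ->
    inner mu (W (fun x => a * f x + g x)) h = a * inner mu (W f) h + inner mu (W g) h.
  move=> Lf Lg Lh; have Lafg := L20_lin a Lf Lg.
  rewrite !WE// [koopman T s _](_ : _ =
    (fun x => a * koopman T s f x + koopman T s g x))//.
  have lV k := fun Lk => (L20_operator_stable hV Lk : L20 mu (V k)).1.
  have lK k := fun Lk => (@L20_koopman s k Lk).1.
  rewrite inner_linl; [|exact: lK|exact: lK|exact: Lh.1].
  have -> : inner mu (V (fun x => a * f x + g x)) h =
      inner mu (fun x => a * V f x + V g x) h.
    apply: inner_ae; [exact: lV|apply: cLfun_lin; exact: lV|exact: Lh.1|].
    exact: L20_operator_linear hV a _ _ Lf Lg.
  rewrite inner_linl; [|exact: lV|exact: lV|exact: Lh.1]; ring.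
have Wpol f g : L20 mu f -> L20 mu g -> inner mu (W f) g = 0.
  move=> Lf Lg.
  have pol a : a * inner mu (W f) g + a^* * inner mu (W g) f = 0.
    have Lafg := L20_lin a Lf Lg.
    have := Wff _ Lafg; rewrite Wlin// !inner_linr ?(Wff _ Lf) ?(Wff _ Lg);
      do ?[exact: (LW _ _).1|exact: Lf.1|exact: Lg.1].
    by move=> <-; ring.
  move: (pol (1 +i* 0)) (pol (0 +i* 1)).
  case: (inner mu (W f) g) => a b; case: (inner mu (W g) f) => a' b'.
  by move=> [h1 h2] [h3 h4]; congr (_ +i* _); move: h1 h2 h3 h4; lra.
move=> f Lf; have := inner_eq0 (LW _ Lf).1 (Wpol _ _ Lf (LW _ Lf)).
by apply: filterS => x; rewrite /W mulNr addrC => /eqP; rewrite subr_eq0 => /eqP.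
Qed.

End Koopman.

(** * Factorization of weak-star limits on a product *)

Section SignedTensor.
Context (R : realType) (U : set_system nat) (UU : UltraFilter U).

Lemma ultra_weak_cst1 d (T : measurableType d) (lam : {finite_measure set T -> \bar R}) :
  ultra_weak U lam (fun _ _ => 1) (fun=> 1).
Proof.
by split; [exact: finite_measure_integrable_cst|move=> B mB; exact: cvg_cst].
Qed.

(** The densities of weak limits come from nonnegative sequences; waves are made
    nonnegative by adding [1]. *)
Lemma ultra_weak_shift d (T : measurableType d) (lam : {finite_measure set T -> \bar R})
    (w_ : nat -> T -> R) : (forall n, measurable_fun setT (w_ n)) ->
  (forall n x, -1 <= w_ n x <= 1) ->
  exists2 f : T -> R, forall x, 0 <= f x & ultra_weak U lam (fun n x => 1 + w_ n x) f.
Proof.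
move=> mw wb.
have [||| f [_ f0] wf] := @ultra_weak_density _ U UU _ _ lam (fun n x => 1 + w_ n x) 2.
- by move=> n; exact: measurable_funD.
- by move=> n x; have := wb n x; lra.
- by move=> n x; have := wb n x; lra.
by exists f.
Qed.

Lemma ultra_weak_tensor_signed d1 d2 (T1 : measurableType d1) (T2 : measurableType d2)
    (lam1 : {finite_measure set T1 -> \bar R}) (lam2 : {finite_measure set T2 -> \bar R})
    (w_ : nat -> T1 -> R) (v_ : nat -> T2 -> R) (f : T1 -> R) (g : T2 -> R) :
  (forall n, measurable_fun setT (w_ n)) -> (forall n, measurable_fun setT (v_ n)) ->
  (forall n x, -1 <= w_ n x <= 1) -> (forall n y, -1 <= v_ n y <= 1) ->
  (forall x, 0 <= f x) -> (forall y, 0 <= g y) ->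
  ultra_weak U lam1 (fun n x => 1 + w_ n x) f ->
  ultra_weak U lam2 (fun n y => 1 + v_ n y) g ->
  ultra_weak U (finite_product lam1 lam2) (fun n z => w_ n z.1 * v_ n z.2)
    (fun z => (f z.1 - 1) * (g z.2 - 1)).
Proof.
move=> mw mv wb vb f0 g0 wf vg.
have mw1 n : measurable_fun setT (fun x => 1 + w_ n x) by exact: measurable_funD.
have mv1 n : measurable_fun setT (fun x => 1 + v_ n x) by exact: measurable_funD.
have wb1 n x : 0 <= 1 + w_ n x <= 2 by have := wb n x; lra.
have vb1 n x : 0 <= 1 + v_ n x <= 2 by have := vb n x; lra.
have b01 : 0 <= (1 : R) <= 2 by lra.
have h0 : 0 <= (1 : R) by [].
have bt (w : T1 -> R) (v : T2 -> R) :
    measurable_fun setT w -> measurable_fun setT v ->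
    (forall x, 0 <= w x <= 2) -> (forall x, 0 <= v x <= 2) ->
    bounded_measurable (fun z : T1 * T2 => w z.1 * v z.2).
  move=> m1 m2 b1 b2; split; first exact: measurable_tensor.
  exists (2 * 2) => z; rewrite normrM ler_pM//.
    by rewrite ger0_norm; case/andP: (b1 z.1).
  by rewrite ger0_norm; case/andP: (b2 z.2).
have t11 := ultra_weak_tensor UU mw1 mv1 wb1 vb1 f0 g0 wf vg.
have t10 := ultra_weak_tensor UU mw1 (fun=> measurable_cst _) wb1 (fun _ _ => b01)
  f0 (fun=> h0) wf (ultra_weak_cst1 lam2).
have t01 := ultra_weak_tensor UU (fun=> measurable_cst _) mv1 (fun _ _ => b01) vb1
  (fun=> h0) g0 (ultra_weak_cst1 lam1) vg.
have t00 := ultra_weak_cst1 (finite_product lam1 lam2).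
have b11 n := bt _ _ (mw1 n) (mv1 n) (wb1 n) (vb1 n).
have b10 n := bt _ (cst 1) (mw1 n) (measurable_cst _) (wb1 n) (fun=> b01).
have b01' n := bt (cst 1) _ (measurable_cst _) (mv1 n) (fun=> b01) (vb1 n).
have b00 (n : nat) := @bounded_measurable_cst _ (T1 * T2)%type R 1.
have s1 := ultra_weak_lin UU 1 (-1) b11 b10 t11 t10.
have s2 := ultra_weak_lin UU 1 (-1) b00 b01' t00 t01.
have bs1 n : bounded_measurable (fun z : T1 * T2 =>
  1 * ((1 + w_ n z.1) * (1 + v_ n z.2)) + -1 * ((1 + w_ n z.1) * cst 1 z.2)).
  by apply: bounded_measurableD; apply: bounded_measurableM => //;
    exact: bounded_measurable_cst.
have bs2 n : bounded_measurable (fun z : T1 * T2 =>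
  1 * cst 1 z + -1 * (cst 1 z.1 * (1 + v_ n z.2))).
  by apply: bounded_measurableD; apply: bounded_measurableM => //;
    exact: bounded_measurable_cst.
have := ultra_weak_lin UU 1 1 bs1 bs2 s1 s2.
congr ultra_weak.
- by apply/funext => n; apply/funext => z /=; ring.
- by apply/funext => z /=; ring.
Qed.

End SignedTensor.

Section Factorization.
Context (R : realType) (sigma lam1 lam2 : {finite_measure set R -> \bar R}).
Context (t_ : nat -> R) (phi : R -> R[i]) (p q : R -> R) (A : set R).
Hypothesis hphi : weak_star_limit sigma (fun n s => expi2pi (t_ n * s)) phi.
Hypothesis bp : bounded_measurable p.
Hypothesis bq : bounded_measurable q.
Hypothesis phip : {ae sigma, forall s, complex.Re (phi s) = p s}.
Hypothesis phiq : {ae sigma, forall s, complex.Im (phi s) = q s}.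
Hypothesis mA : measurable A.

Local Notation lam12 := (finite_product lam1 lam2).
Let add2 (z : R * R) := z.1 + z.2.

Hypothesis domA : forall B, measurable B -> sigma B = 0%E ->
  lam12 (add2 @^-1` (B `&` A)) = 0%E.

Lemma measurable_add2 : measurable_fun [set: R * R] add2.
Proof. by apply: measurable_funD; [exact: measurable_fst|exact: measurable_snd]. Qed.

(** A character of [x + y] is the product of a character of [x] and one of [y], and
    weak limits along an ultrafilter are multiplicative on such products. The
    limit computed through [sigma] must be the same wherever [sigma] dominates. *)
Lemma weak_star_factorization : exists phi1 phi2 : R -> R[i],
  {ae lam12, forall z, A (z.1 + z.2) ->
    phi1 z.1 * phi2 z.2 = p (z.1 + z.2) +i* q (z.1 + z.2)}.
Proof.
have [U [UU Uoo]] := ultraFilterLemma eventually_filter.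
pose C n (x : R) := cos (2 * pi * (t_ n * x)).
pose S n (x : R) := sin (2 * pi * (t_ n * x)).
have mt n : measurable_fun setT (fun x : R => 2 * pi * (t_ n * x)).
  by do 2 apply: measurable_funM => //.
have mC n : measurable_fun setT (C n) := (bounded_measurable_cos (mt n)).1.
have mS n : measurable_fun setT (S n) := (bounded_measurable_sin (mt n)).1.
have Cb n x : -1 <= C n x <= 1 by rewrite cos_geN1 cos_le1.
have Sb n x : -1 <= S n x <= 1 by rewrite sin_geN1 sin_le1.
(* [c1 - 1] and [s1 - 1] are the weak limits of the real and imaginary parts of
   the characters with respect to [lam1]; similarly for [lam2]. *)
have [c1 c10 wc1] := ultra_weak_shift UU lam1 mC Cb.
have [s1 s10 ws1] := ultra_weak_shift UU lam1 mS Sb.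
have [c2 c20 wc2] := ultra_weak_shift UU lam2 mC Cb.
have [s2 s20 ws2] := ultra_weak_shift UU lam2 mS Sb.
exists (fun x => (c1 x - 1) +i* (s1 x - 1)), (fun y => (c2 y - 1) +i* (s2 y - 1)).
have bt (w v : R -> R) : measurable_fun setT w -> measurable_fun setT v ->
    (forall x, -1 <= w x <= 1) -> (forall x, -1 <= v x <= 1) ->
    bounded_measurable (fun z : R * R => w z.1 * v z.2).
  move=> m1 m2 b1 b2; split; first exact: measurable_tensor.
  by exists (1 * 1) => z; rewrite normrM ler_pM// ler_norml.
have tcc := ultra_weak_tensor_signed UU mC mC Cb Cb c10 c20 wc1 wc2.
have tss := ultra_weak_tensor_signed UU mS mS Sb Sb s10 s20 ws1 ws2.
have tcs := ultra_weak_tensor_signed UU mC mS Cb Sb c10 s20 wc1 ws2.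
have tsc := ultra_weak_tensor_signed UU mS mC Sb Cb s10 c20 ws1 wc2.
have bcc n := bt _ _ (mC n) (mC n) (Cb n) (Cb n).
have bss n := bt _ _ (mS n) (mS n) (Sb n) (Sb n).
have bcs n := bt _ _ (mC n) (mS n) (Cb n) (Sb n).
have bsc n := bt _ _ (mS n) (mC n) (Sb n) (Cb n).
have [iP cP] := ultra_weak_lin UU 1 (-1) bcc bss tcc tss.
have [iQ cQ] := ultra_weak_lin UU 1 1 bsc bcs tsc tcs.
have mE : measurable (add2 @^-1` A).
  by rewrite -[X in measurable X]setTI; exact: measurable_add2.
have lim D : measurable D -> D `<=` add2 @^-1` A ->
    \int[lam12]_(z in D) (1 * ((c1 z.1 - 1) * (c2 z.2 - 1))
                         + -1 * ((s1 z.1 - 1) * (s2 z.2 - 1)))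
      = \int[lam12]_(z in D) p (z.1 + z.2) /\
    \int[lam12]_(z in D) (1 * ((s1 z.1 - 1) * (c2 z.2 - 1))
                         + 1 * ((c1 z.1 - 1) * (s2 z.2 - 1)))
      = \int[lam12]_(z in D) q (z.1 + z.2).
  move=> mD DA.
  have [|cc cs] := weak_star_transfer hphi bp bq phip phiq (m := lam12)
      measurable_add2 mD.
    move=> B mB B0; have mBA := measurableI _ _ mB mA.
    have mB' : measurable (add2 @^-1` B).
      by rewrite -[X in measurable X]setTI; exact: measurable_add2.
    have mBA' : measurable (add2 @^-1` (B `&` A)).
      by rewrite -[X in measurable X]setTI; exact: measurable_add2.
    apply/eqP; rewrite -measure_le0 -(domA mB B0) le_measure ?inE//.
      exact: measurableI.
    by move=> z [Bz /DA].
  have angle n z : 2 * pi * (t_ n * add2 z) =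
      2 * pi * (t_ n * z.1) + 2 * pi * (t_ n * z.2) by rewrite /add2; ring.
  have ccU : \int[lam12]_(z in D) cos (2 * pi * (t_ n * add2 z)) @[n --> U] -->
    \int[lam12]_(z in D) p (add2 z) by move=> B /cc/Uoo.
  have csU : \int[lam12]_(z in D) sin (2 * pi * (t_ n * add2 z)) @[n --> U] -->
    \int[lam12]_(z in D) q (add2 z) by move=> B /cs/Uoo.
  split.
  - apply: (cvg_unique _ (cP D mD)) => //.
    rewrite (_ : (fun n => _) =
      (fun n => \int[lam12]_(z in D) cos (2 * pi * (t_ n * add2 z))))//.
    apply/funext => n; apply: eq_Rintegral => z _.
    by rewrite angle cosD /C /S; ring.
  - apply: (cvg_unique _ (cQ D mD)) => //.
    rewrite (_ : (fun n => _) =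
      (fun n => \int[lam12]_(z in D) sin (2 * pi * (t_ n * add2 z))))//.
    apply/funext => n; apply: eq_Rintegral => z _.
    by rewrite angle sinD /C /S; ring.
have bpadd (g : R -> R) : bounded_measurable g ->
    bounded_measurable (fun z : R * R => g (z.1 + z.2)).
  move=> [mg [M gM]]; split; first exact: (measurableT_comp mg measurable_add2).
  by exists M => z.
have ae1 (F : R * R -> R) (g : R -> R) : 
    lam12.-integrable setT (EFin \o F) -> bounded_measurable g ->
    (forall D, measurable D -> D `<=` add2 @^-1` A ->
      \int[lam12]_(z in D) F z = \int[lam12]_(z in D) g (z.1 + z.2)) ->
    {ae lam12, forall z, A (z.1 + z.2) -> F z = g (z.1 + z.2)}.
  move=> iF bg FG.
  have ig := bounded_measurable_integrable lam12 measurableT (bpadd _ bg).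
  have : ae_eq lam12 (add2 @^-1` A) (EFin \o F) (EFin \o (fun z => g (z.1 + z.2))).
    apply: integral_ae_eq => //.
    - exact: integrableS iF.
    - by apply: measurable_funTS; exact: measurable_int ig.
    - move=> D DA mD.
      rewrite -[LHS]fineK; last by apply: integrable_fin_num => //; exact: integrableS iF.
      rewrite -[RHS]fineK; last by apply: integrable_fin_num => //; exact: integrableS ig.
      by congr (_%:E); exact: FG.
  by apply: filterS => z zA /zA[].
have := ae1 _ _ iP bp (fun D mD DA => (lim D mD DA).1).
have := ae1 _ _ iQ bq (fun D mD DA => (lim D mD DA).2).
apply: filterS2 => z hQ hP Az; rewrite -(hP Az) -(hQ Az).
by congr (_ +i* _) => /=; ring.
Qed.

End Factorization.

(** * The spectral type is singular to convolutions *)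

Section ExponentialMultiplier.
Context d (X : measurableType d) (R : realType) (mu : probability X R)
  (T : R -> X -> X) (sigma : {finite_measure set R -> \bar R}).

Lemma cintegral_exponential (nu : {finite_measure set R -> \bar R}) (phi : R -> R[i])
    (c : R[i]) (s0 : R) :
  measurable_fun setT (fun s => complex.Re (phi s)) ->
  measurable_fun setT (fun s => complex.Im (phi s)) ->
  {ae nu, forall s, phi s = c * expi2pi (s0 * s)} ->
  cintegral nu phi = c * cintegral nu (fun s => expi2pi (s0 * s)).
Proof.
move=> mr mi; case: c => a b phiE.
have mt : measurable_fun setT (fun s : R => 2 * pi * (s0 * s)).
  by do 2 apply: measurable_funM => //.
have bc := bounded_measurable_cos mt; have bs := bounded_measurable_sin mt.
have ic := bounded_measurable_integrable nu measurableT bc.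
have js := bounded_measurable_integrable nu measurableT bs.
have bZ (e : R) g : bounded_measurable g -> bounded_measurable (fun s : R => e * g s).
  by move=> bg; apply: bounded_measurableM => //; exact: bounded_measurable_cst.
have lin (e1 e2 : R) :
    \int[nu]_s (e1 * cos (2 * pi * (s0 * s)) + e2 * sin (2 * pi * (s0 * s))) =
    e1 * (\int[nu]_s cos (2 * pi * (s0 * s))) + e2 * (\int[nu]_s sin (2 * pi * (s0 * s))).
  rewrite RintegralD//; [by rewrite !RintegralZl| |];
    by apply: bounded_measurable_integrable => //; exact: bZ.
have mlin (e1 e2 : R) : measurable_fun setT
    (fun s : R => e1 * cos (2 * pi * (s0 * s)) + e2 * sin (2 * pi * (s0 * s))).
  by apply: measurable_funD; [exact: (bZ _ _ bc).1|exact: (bZ _ _ bs).1].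
apply/eqP; rewrite eq_complex; apply/andP; split; apply/eqP.
- transitivity (\int[nu]_s (a * cos (2 * pi * (s0 * s)) + - b * sin (2 * pi * (s0 * s)))).
    rewrite /= /Rintegral; congr fine; apply: ae_eq_integral => //.
    + by apply/measurable_EFinP; exact: mr.
    + by apply/measurable_EFinP; exact: mlin.
    + by apply: filterS phiE => s /= -> _; congr (_%:E); rewrite /=; ring.
  by rewrite lin /cintegral /expi2pi /=; ring.
- transitivity (\int[nu]_s (b * cos (2 * pi * (s0 * s)) + a * sin (2 * pi * (s0 * s)))).
    rewrite /= /Rintegral; congr fine; apply: ae_eq_integral => //.
    + by apply/measurable_EFinP; exact: mi.
    + by apply/measurable_EFinP; exact: mlin.
    + by apply: filterS phiE => s /= -> _; congr (_%:E); rewrite /=; ring.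
  by rewrite lin /cintegral /expi2pi /=; ring.
Qed.

Lemma scaled_koopman_of_exponential (t_ : nat -> R) V (phi : R -> R[i])
    (c : R[i]) (s0 : R) : measurable_mp_flow mu T ->
  reduced_maximal_spectral_type mu T sigma -> L20_operator mu V ->
  spectral_multiplier mu T sigma t_ V phi ->
  {ae sigma, forall s, phi s = c * expi2pi (s0 * s)} ->
  is_scaled_koopman mu T V c s0.
Proof.
move=> hT [dom _] hV [[Lphi _] hq] phiE.
apply: scaled_koopman_of_quadratic => // f Lf.
have [nu [fnu nus]] := dom f Lf.
have [mr mi] := cLfun_measurable Lphi.
rewrite (hq f nu Lf fnu) (fnu s0); apply: cintegral_exponential => //.
case: phiE => N [mN N0 sN]; exists N; split => //.
by move/null_content_dominatesP : nus; apply.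
Qed.

End ExponentialMultiplier.

Theorem proposition10 (R : realType) (d : measure_display)
  (X : measurableType d) (mu : probability X R) (T : R -> X -> X)
  (hX : standard_borel X R)
  (hT : measurable_mp_flow mu T)
  (hTerg : ergodic_flow mu T)
  (sigma : {finite_measure set R -> \bar R})
  (hsigma : reduced_maximal_spectral_type mu T sigma)
  (t_ : nat -> R) (V : (X -> R[i]) -> (X -> R[i])) (phiV : R -> R[i])
  (hV : L20_operator mu V)
  (hcvg : koopman_cvg_weakly mu T t_ V)
  (hVT : ~ exists (c : R[i]) (s : R), is_scaled_koopman mu T V c s)
  (hphi : spectral_multiplier mu T sigma t_ V phiV)
  (hana : exists2 h : R -> R[i], real_analytic h &
    {ae sigma, forall s, phiV s = h s}) :
  forall lam1 lam2 : {finite_measure set R -> \bar R},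
    continuous_measure lam1 -> continuous_measure lam2 ->
    mutually_singular sigma (convolution lam1 lam2).
Proof.
move=> lam1 lam2 c1 c2.
pose lam12 := finite_product lam1 lam2.
have madd : measurable_fun [set: R * R] (fun z : R * R => z.1 + z.2) :=
  @measurable_add2 R.
have mpre A : measurable A -> measurable ((fun z : R * R => z.1 + z.2) @^-1` A).
  by move=> mA; rewrite -[X in measurable X]setTI; exact: madd.
(* [sigma] lives on [A], where it dominates the convolution: singularity means
   that the convolution does not charge [A]. *)
have [A [mA sA domA]] := absolutely_continuous_part sigma
  (image_measure lam12 madd measurableT).
have kA_null B : measurable B -> sigma B = 0%E ->
    lam12 ((fun z : R * R => z.1 + z.2) @^-1` (B `&` A)) = 0%E.
  by move=> mB B0; rewrite -(domA _ mB B0) /= /image_measure setIT.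
have [kA0|kA] := eqVneq (lam12 ((fun z : R * R => z.1 + z.2) @^-1` A)) 0%E.
  exists (~` A); first exact: measurableC.
  by split=> //; rewrite setCK.
exfalso; apply: hVT.
have [hweak _] := hphi; have [Lphi _] := hweak.
have [p bp phip] := Lfun_infty_bounded Lphi.1.
have [q bq phiq] := Lfun_infty_bounded Lphi.2.
have sigmaN := spectral_type_symmetric hsigma.
have [pN qN] := multiplier_symmetric sigmaN hweak bp bq phip phiq.
have [h /real_analytic_canalytic ah phih] := hana.
(* Off a [sigma]-null set [N], the analytic function [h] agrees with [p + i q] and
   is hermitian; reflected null sets are null, which gives the value at [- s]. *)
have : {ae sigma, forall s, h s = p s +i* q s}.
  apply: filterS3 phip phiq phih => s hp hq <-.
  by rewrite -hp -hq; case: (phiV s).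
case=> N1 [mN1 N10 hN1].
have : {ae sigma, forall s, p (- s) = p s /\ q (- s) = - q s}.
  by apply: filterS2 pN qN.
case=> N2 [mN2 N20 hN2].
pose N := N1 `|` (-%R @^-1` N1) `|` N2.
have mN1' : measurable (-%R @^-1` N1 : set R).
  by rewrite -[X in measurable X]setTI; exact: oppr_measurable.
have mN : measurable N by do 2 apply: measurableU => //.
have N0 : sigma N = 0%E.
  apply/negligibleP => //; apply: negligibleU; last exact/negligibleP.
  apply: negligibleU; first exact/negligibleP.
  by apply/negligibleP => //; exact: sigmaN.
have hpq s : ~ N s -> h s = p s +i* q s.
  by move=> Ns; apply: contrapT => hs; apply: Ns; do 2 left; exact: hN1.
have hherm s : ~ N s -> h (- s) = (h s)^*.
  move=> Ns; rewrite (hpq s Ns).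
  have -> : h (- s) = p (- s) +i* q (- s).
    by apply: contrapT => hs; apply: Ns; left; right; exact: hN1.
  have [-> ->] : p (- s) = p s /\ q (- s) = - q s; last by [].
  by apply: contrapT => hs; apply: Ns; right; exact: hN2.
pose A' := A `\` N.
have mA' : measurable A' by exact: measurableD.
have domA' B : measurable B -> sigma B = 0%E ->
    lam12 ((fun z : R * R => z.1 + z.2) @^-1` (B `&` A')) = 0%E.
  move=> mB B0; apply/eqP; rewrite -measure_le0 -[leRHS](kA_null _ mB B0).
  rewrite le_measure ?inE//.
  - by apply: mpre; exact: measurableI.
  - by apply: mpre; exact: measurableI.
  - by move=> z [Bz [Az _]].
have [phi1 [phi2 fac]] :=
  weak_star_factorization hweak bp bq phip phiq mA' domA'.
case: fac => M [mM M0 hM].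
pose E := (fun z : R * R => z.1 + z.2) @^-1` A' `\` M.
have mE : measurable E by apply: measurableD => //; exact: mpre.
have E0 : lam12 E != 0%E.
  apply: contra_neq kA => E0; apply/negligibleP; first exact: mpre.
  apply: (@negligibleS _ _ _ _
    (E `|` M `|` (fun z : R * R => z.1 + z.2) @^-1` (N `&` A))).
    move=> z Az; have [Nz|Nz] := pselect (N (z.1 + z.2)); first by right.
    by left; have [Mz|Mz] := pselect (M z); [right|left].
  apply: negligibleU; first by apply: negligibleU; exact/negligibleP.
  apply/negligibleP; first by apply: mpre; exact: measurableI.
  exact: kA_null.
have EA' z : E z -> A' (z.1 + z.2) by case.
have Efac z : E z -> phi1 z.1 * phi2 z.2 = h (z.1 + z.2).
  move=> [Az Mz]; rewrite hpq; last by case: Az.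
  by apply: contrapT => nz; apply: Mz; apply: hM => /(_ Az).
have hmul := sum_factorization_rigid c1 c2 ah mE E0 Efac.
(* Some section of [E] has positive mass, and [h] is hermitian at the sums [x + y]
   along it, hence everywhere by analyticity. *)
have herm s : h (- s) = (h s)^*.
  have [x Ex] : exists x, lam2 (xsection E x) != 0%E.
    apply: contrapT => /forallNP nE; move/negP: E0; apply; apply/eqP.
    rewrite /lam12 /finite_product /product_measure1; apply: integral0_eq => x _ /=.
    by apply/eqP; apply: contrapT => /negP; exact: nE.
  have agree : forall y, 1 * h (x + y) - 1 * ((h (- (x + y)))^*)%C = 0.
    apply: (canalytic_identity_measure c2 _ (measurable_xsection x mE) Ex).
      apply: canalytic_lin; first exact: canalytic_shift.
      exact: (canalytic_shift x (canalytic_conjN ah)).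
    move=> y /set_mem[[_ Nxy] _].
    by rewrite (hherm _ Nxy) conjcK subrr.
  have := agree (s - x); have -> : x + (s - x) = s by ring.
  rewrite !mul1r => /eqP; rewrite subr_eq0 => /eqP e.
  by rewrite e conjcK.
have [c [s0 hexp]] := hermitian_exponential ah herm hmul.
exists c, s0; apply: scaled_koopman_of_exponential hphi _ => //.
by apply: filterS phih => s ->.
Qed.
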